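(* Let $\mathcal F$ be a saturated fusion system over a finite $p$-group $S$, let $\mathscr P\subseteq\mathcal F^c$ be a family of subgroups closed under $\mathcal F$-conjugacy and containing $\mathcal F^{cr}$, and let $\mathcal F^{\mathscr P}\subseteq\mathcal F^c$ be the full subcategory with object set $\mathscr P$. Then the restriction $$\theta_{\mathcal F}^{\mathscr P}=\theta_{\mathcal F}|_{\mathrm{Mor}(\mathcal F^{\mathscr P})}\colon\mathrm{Mor}(\mathcal F^{\mathscr P})\longrightarrow\Gamma_{p'}(\mathcal F)$$ is universal among all strongly multiplicative maps $\mathrm{Mor}(\mathcal F^{\mathscr P})\to\Gamma$; that is, for each group $\Gamma$ and each strongly multiplicative map $\theta\colon\mathrm{Mor}(\mathcal F^{\mathscr P})\to\Gamma$, there is a unique homomorphism $f\colon\Gamma_{p'}(\mathcal F)\to\Gamma$ such that $\theta=f\circ\theta_{\mathcal F}^{\mathscr P}$.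
   Context: Fusion systems. For a prime $p$ and a finite $p$-group $S$, a fusion system over $S$ is a category $\mathcal F$ whose objects are the subgroups of $S$, whose morphisms are injective group homomorphisms between subgroups (with the usual composition), such that for all $P,Q\le S$: $\mathrm{Hom}_{\mathcal F}(P,Q)$ contains every $c_g=(x\mapsto gxg^{-1})$ with $g\in S$, $gPg^{-1}\le Q$; and for each $\varphi\in \mathrm{Hom}_{\mathcal F}(P,Q)$, $\varphi^{-1}\in \mathrm{Hom}_{\mathcal F}(\varphi(P),P)$. Write $\mathrm{Aut}_{\mathcal F}(P)=\mathrm{Hom}_{\mathcal F}(P,P)$, $\mathrm{Out}_{\mathcal F}(P)=\mathrm{Aut}_{\mathcal F}(P)/\mathrm{Inn}(P)$, $P^{\mathcal F}=\{\varphi(P)\mid\varphi\in\mathrm{Hom}_{\mathcal F}(P,S)\}$ (the $\mathcal F$-conjugacy class of $P$). $P$ is fully normalized (fully centralized) in $\mathcal F$ if $|N_S(P)|\ge|N_S(Q)|$ ($|C_S(P)|\ge|C_S(Q)|$) for all $Q\in P^{\mathcal F}$. $\mathcal F$ is saturated if (I) for each fully normalized $P\le S$, $P$ is fully centralized and $\mathrm{Aut}_S(P)\in\mathrm{Syl}_p(\mathrm{Aut}_{\mathcal F}(P))$; and (II) each isomorphism $\varphi\in\mathrm{Iso}_{\mathcal F}(P,Q)$ with $Q$ fully centralized extends to a morphism in $\mathrm{Hom}_{\mathcal F}(N_\varphi,S)$, where $N_\varphi=\{g\in N_S(P)\mid \varphi c_g\varphi^{-1}\in\mathrm{Aut}_S(Q)\}$.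 $P\le S$ is $\mathcal F$-centric if $C_S(Q)\le Q$ for all $Q\in P^{\mathcal F}$, and $\mathcal F$-radical if $O_p(\mathrm{Out}_{\mathcal F}(P))=1$. $\mathcal F^c\supseteq\mathcal F^{cr}$ denote the sets of $\mathcal F$-centric, resp. $\mathcal F$-centric $\mathcal F$-radical, subgroups of $S$, and also the full subcategories of $\mathcal F$ with those objects. Let $O^{p'}_*(\mathcal F)\le\mathcal F$ be the fusion subsystem over $S$ generated by the groups $O^{p'}(\mathrm{Aut}_{\mathcal F}(P))$ for all $P\le S$ (i.e. the smallest fusion system over $S$, not necessarily saturated, containing them). Let $\mathrm{Aut}^0_{\mathcal F}(S)$ be the subgroup generated by all $\alpha\in\mathrm{Aut}_{\mathcal F}(S)$ such that $\alpha|_P\in\mathrm{Hom}_{O^{p'}_*(\mathcal F)}(P,S)$ for some $P\in\mathcal F^c$, and set $\Gamma_{p'}(\mathcal F)=\mathrm{Aut}_{\mathcal F}(S)/\mathrm{Aut}^0_{\mathcal F}(S)$. For a full subcategory $\mathcal F_0\subseteq\mathcal F$ with $S\in\mathrm{Ob}(\mathcal F_0)$, a map $\theta\colon\mathrm{Mor}(\mathcal F_0)\to\Gamma$ to a group $\Gamma$ is multiplicative if it sends composites to products and inclusions to the identity; it is strongly multiplicative if in addition $\theta(O^{p'}(\mathrm{Aut}_{\mathcal F}(P)))=1$ for each $P\in\mathrm{Ob}(\mathcal F_0)$. Known fact defining $\theta_{\mathcal F}$: there is a unique multiplicative map $\theta_{\mathcal F}\colon\mathrm{Mor}(\mathcal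 F^c)\to\Gamma_{p'}(\mathcal F)$ whose restriction to $\mathrm{Aut}_{\mathcal F}(S)$ is the natural surjection; it is strongly multiplicative, and is universal among strongly multiplicative maps on $\mathrm{Mor}(\mathcal F^c)$. *)

(* Defs.v *)
From HB Require Import structures.
From mathcomp Require Import all_boot all_fingroup all_solvable.
From mathcomp Require Import boolp.

Set Implicit Arguments.
Unset Strict Implicit.
Unset Printing Implicit Defensive.

Local Open Scope group_scope.

(** Conventions. Everything lives in an ambient finite group type [gT].
    As for [{perm T}] and [conjg] in MathComp, maps act on the right and are
    composed from left to right: the product of [f] and [g] is "first [f], then
    [g]", and the conjugation by [g] is [x |-> x ^ g = g^-1 * x * g].  Passing to
    opposite groups (and [g] to [g^-1]) recovers the right-to-left convention.

    A homomorphism defined on [P] is encoded by the unique [{ffun gT -> gT}] that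
    agrees with it on [P] and is the identity off [P] (the normalization that
    [Aut P] uses for permutations), so that equality of morphisms with given
    source and target is Leibniz equality. *)

Section Maps.

Variable gT : finGroupType.
Implicit Types P Q : {group gT}.

Definition frestr (P : {set gT}) (f : gT -> gT) : {ffun gT -> gT} :=
  [ffun x => if x \in P then f x else x].

Definition fcomp P (f g : {ffun gT -> gT}) := frestr P (g \o f).

(* The inverse of a map injective on [P], as a map on [f @: P]. *)
Definition finvon P (f : {ffun gT -> gT}) : {ffun gT -> gT} :=
  [ffun y => odflt y [pick x in P | f x == y]].

Definition injhom P Q (f : {ffun gT -> gT}) : Prop :=
  [/\ morphic P f, {in P &, injective f}, f @: P \subset Q
    & forall x, x \notin P -> f x = x].

End Maps.

(* The smallest normal subgroup of [A] of index prime to [p]. *)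
Definition Op'res (aT : finGroupType) (p : nat) (A : {set aT}) : {set aT} :=
  \bigcap_(H : {group aT} | (H <| A) && p^'.-nat #|A : H|) H.

Record fusion_system (gT : finGroupType) (S : {group gT}) := FusionSystem {
  fhom :> {group gT} -> {group gT} -> {set {ffun gT -> gT}};
  fhom_sub : forall P Q f, f \in fhom P Q ->
    [/\ P \subset S, Q \subset S & injhom P Q f];
  fhom_comp : forall P Q R f g, f \in fhom P Q -> g \in fhom Q R ->
    fcomp P f g \in fhom P R;
  fhom_conj : forall (P Q : {group gT}) g, P \subset S -> Q \subset S -> g \in S ->
    P :^ g \subset Q -> frestr P (conjg^~ g) \in fhom P Q;
  fhom_inv : forall P Q (R : {group gT}) f, f \in fhom P Q -> f @: P = R ->
    finvon P f \in fhom R P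
}.

Section Fusion.

Variables (gT : finGroupType) (S : {group gT}) (F : fusion_system S).
Implicit Types P Q R : {group gT}.

Definition AutF P : {set {perm gT}} := [set a in Aut P | frestr P a \in F P P].

Lemma AutF_group_set P : P \subset S -> group_set (AutF P).
Proof.
move=> sPS; apply/group_setP; split=> [|a b].
  rewrite inE group1; have := fhom_conj F sPS sPS (group1 S).
  rewrite conjsg1 => /(_ (subxx _)); congr (_ \in F P P).
  by apply/ffunP=> x; rewrite !ffunE conjg1 perm1.
case/setIdP=> Aa Fa /setIdP[Ab Fb]; apply/setIdP; split; first exact: groupM.
have := fhom_comp Fa Fb; congr (_ \in F P P).
apply/ffunP=> x; rewrite !ffunE /= !ffunE permM.
by case: (boolP (x \in P)) => // Px; rewrite (Aut_closed Aa Px).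
Qed.

Definition AutS P : {set {perm gT}} := conj_aut P @* 'N_S(P).
Definition Inn P : {set {perm gT}} := conj_aut P @* P.
Definition OutF P := AutF P / Inn P.

Definition fclass P : {set {group gT}} :=
  [set Q : {group gT} | [exists f in F P S, f @: P == Q]].

Definition fully_normalized P :=
  P \subset S /\ {in fclass P, forall Q : {group gT}, #|'N_S(Q)| <= #|'N_S(P)|}.
Definition fully_centralized P :=
  P \subset S /\ {in fclass P, forall Q : {group gT}, #|'C_S(Q)| <= #|'C_S(P)|}.

(* For an isomorphism [f] from [P] to [Q]; the condition on [b] says that
   [f^-1 * c_g * f = b] as automorphisms of [Q]. *)
Definition Nphi P Q (f : {ffun gT -> gT}) : {set gT} :=
  [set g in 'N_S(P) |
    [exists b in AutS Q, [forall x in P, f (x ^ g) == b (f x)]]].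

Lemma Nphi_group_set P Q f : group_set (Nphi P Q f).
Proof.
apply/group_setP; split=> [|g h].
  rewrite inE group1; apply/exists_inP; exists 1; first exact: group1.
  by apply/forall_inP=> x Px; rewrite conjg1 perm1.
case/setIdP=> Ng /exists_inP[b Bb /forall_inP bE].
case/setIdP=> Nh /exists_inP[c Bc /forall_inP cE].
apply/setIdP; split; first exact: groupM.
apply/exists_inP; exists (b * c); first exact: groupM.
apply/forall_inP=> x Px; have [_ nPg] := setIP Ng.
have Pxg : x ^ g \in P by rewrite memJ_norm.
by rewrite conjgM (eqP (cE _ Pxg)) (eqP (bE _ Px)) permM.
Qed.
Canonical Nphi_group P Q f := Group (Nphi_group_set P Q f).

Definition fsaturated (p : nat) : Prop :=
  (forall P, fully_normalized P ->
     fully_centralized P /\ p.-Sylow(AutF P) (AutS P)) /\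
  (forall P Q f, f \in F P Q -> f @: P = Q -> fully_centralized Q ->
     exists2 g, g \in F [group of Nphi P Q f] S & {in P, g =1 f}).

Definition fcentric : {set {group gT}} :=
  [set P : {group gT} | (P \subset S) &&
     [forall Q : {group gT}, (Q \in fclass P) ==> ('C_S(Q) \subset Q)]].

Definition fradical (p : nat) P : bool := 'O_p(OutF P) == 1.

Definition conj_closed (C : {set {group gT}}) : Prop :=
  forall P Q, P \in C -> Q \in fclass P -> Q \in C.

Section Generated.

Variable p : nat.

Definition contains_Op' (E : fusion_system S) : Prop :=
  forall P, P \subset S ->
    {in Op'res p (AutF P), forall a : {perm gT}, frestr P a \in E P P}.

Definition Opstar_hom P Q : {set {ffun gT -> gT}} :=
  [set f | `[< forall E : fusion_system S, contains_Op' E -> f \in E P Q >]].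

Lemma Opstar_homP P Q f :
  reflect (forall E, contains_Op' E -> f \in E P Q) (f \in Opstar_hom P Q).
Proof. by rewrite inE; exact: asboolP. Qed.

Lemma contains_Op'_self : contains_Op' F.
Proof.
move=> P sPS a; pose A := Group (AutF_group_set sPS).
rewrite -[AutF P]/(gval A) => /bigcapP/(_ A).
by rewrite normal_refl indexgg => /(_ isT)/setIdP[].
Qed.

Lemma Opstar_sub P Q : Opstar_hom P Q \subset F P Q.
Proof. by apply/subsetP=> f /Opstar_homP; apply; exact: contains_Op'_self. Qed.

Lemma Opstar_fhom_sub P Q f : f \in Opstar_hom P Q ->
  [/\ P \subset S, Q \subset S & injhom P Q f].
Proof. by move/(subsetP (Opstar_sub P Q)); exact: fhom_sub. Qed.

Lemma Opstar_fhom_comp P Q R f g :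
  f \in Opstar_hom P Q -> g \in Opstar_hom Q R -> fcomp P f g \in Opstar_hom P R.
Proof.
move=> /Opstar_homP Hf /Opstar_homP Hg; apply/Opstar_homP=> E HE.
exact: fhom_comp (Hf E HE) (Hg E HE).
Qed.

Lemma Opstar_fhom_conj P Q g : P \subset S -> Q \subset S -> g \in S ->
  P :^ g \subset Q -> frestr P (conjg^~ g) \in Opstar_hom P Q.
Proof.
by move=> sP sQ Sg sPQ; apply/Opstar_homP=> E _; exact: fhom_conj.
Qed.

Lemma Opstar_fhom_inv P Q R f : f \in Opstar_hom P Q -> f @: P = R ->
  finvon P f \in Opstar_hom R P.
Proof.
move=> /Opstar_homP Hf fPR; apply/Opstar_homP=> E HE.
exact: fhom_inv (Hf E HE) fPR.
Qed.

Definition Opstar : fusion_system S := FusionSystem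
  Opstar_fhom_sub Opstar_fhom_comp Opstar_fhom_conj Opstar_fhom_inv.

Lemma Opstar_contains : contains_Op' Opstar.
Proof.
by move=> P sPS a Oa; apply/Opstar_homP=> E; exact.
Qed.

Definition Aut0 : {set {perm gT}} :=
  <<[set a in AutF S |
      [exists P : {group gT}, (P \in fcentric) && (frestr P a \in Opstar P S)]]>>.

Canonical AutFS_group := Group (AutF_group_set (subxx S)).

(* [Aut0] is normal in [AutF S]: both its generators and [Opstar] are invariant
   under conjugation by [AutF S]. *)
Definition Gamma_p' : finGroupType := subg_of [group of AutF S / Aut0].

Definition AutFS_proj (a : {perm gT}) : Gamma_p' :=
  subg [group of AutF S / Aut0] (coset Aut0 a).

End Generated.

(* A map on the morphisms of a full subcategory with object set [C] is given by
   a total function of the source, the target and the underlying map; only its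
   values on [f \in F P Q] with [P, Q \in C] are meaningful. *)
Definition mor_map (Gamma : Type) :=
  {group gT} -> {group gT} -> {ffun gT -> gT} -> Gamma.

Definition multiplicative_map (C : {set {group gT}}) (Gamma : groupType)
    (theta : mor_map Gamma) : Prop :=
  (forall P Q R f g, P \in C -> Q \in C -> R \in C ->
     f \in F P Q -> g \in F Q R ->
     theta P R (fcomp P f g) = theta P Q f * theta Q R g) /\
  (forall P Q, P \in C -> Q \in C -> P \subset Q ->
     theta P Q (frestr P id) = 1).

Definition strongly_multiplicative (p : nat) (C : {set {group gT}})
    (Gamma : groupType) (theta : mor_map Gamma) : Prop :=
  multiplicative_map C theta /\
  (forall P (a : {perm gT}), P \in C -> a \in Op'res p (AutF P) ->
     theta P P (frestr P a) = 1).

(* The defining property of [theta_F]. *)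
Definition is_theta (p : nat) (theta : mor_map (Gamma_p' p)) : Prop :=
  multiplicative_map fcentric theta /\
  {in AutF S, forall a : {perm gT},
    theta S S (frestr S a) = AutFS_proj p a}.

End Fusion.

(* Main.v *)
Require Import Defs.
From HB Require Import structures.
From mathcomp Require Import all_boot all_fingroup all_solvable.
From mathcomp Require Import boolp.

Set Implicit Arguments.
Unset Strict Implicit.
Unset Printing Implicit Defensive.

Local Open Scope group_scope.

(** Why the theorem holds.

    A strongly multiplicative map [theta] on [C] need not see every centric
    subgroup, whereas the group [Aut0] by which [Gamma_p'] is the quotient is
    defined through all of them.  So [theta] is first extended to a strongly
    multiplicative map [t] on all centric subgroups ([extend_to_centric]), one
    conjugacy class at a time, from large subgroups to small ones.  Let [P] be a
    largest centric subgroup not yet reached, fully normalized in its class.  It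
    is not radical, so the preimage [T] in ['N_S(P)] of ['O_p(AutF F P)] is
    strictly larger than [P]; as that core is normal in [AutF F P], saturation
    extends every automorphism of [P] to one of [T] ([nonradical_ext]), on which
    the map is already known.  The value so obtained depends on the automorphism
    of [P] alone: two extensions agreeing on the centric subgroup [P] differ by
    an automorphism of [p]-power order, which is sent to 1 ([smult_agree]).
    Every [Q] conjugate to [P] is carried to [P] by a morphism defined on
    ['N_S(Q)] ([transporter]), and ['N_S(Q)] is again larger than [Q], so the
    value of an arbitrary [Q -> Q'] is forced, and the resulting formula works
    ([smult_extend_mult]).

    The extension kills [Aut0]: the morphisms that [t] sends to 1 form a fusion
    system containing every [Op'res p (AutF F P)], hence containing [Opstar F p];
    so an [a] in [AutF F S] whose restriction to some centric [P] lies in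
    [Opstar F p] has [t S a = t P a = 1] ([Aut0_val]).  Therefore [t S] factors
    through a homomorphism [f] on [Gamma_p'].

    Finally [t] and [f \o theta_F] are strongly multiplicative on the centric
    subgroups and agree on [AutF F S], and such maps are equal ([smult_unique]):
    for [P] fully normalized, the Frattini argument writes an automorphism of
    [P] as one killed by both maps times one normalizing [AutS S P], and the
    latter extends to ['N_S(P)]; induct downwards on [P].

    That [theta_F] itself is strongly multiplicative, as well as the radicality
    of [S], comes from [AutS S S] being a Sylow subgroup of [AutF F S], which
    makes [Gamma_p'] a [p']-group. *)

(** * Morphisms of a fusion system as functions with target [S] *)

Section Morphisms.

Variables (gT : finGroupType) (S : {group gT}) (F : fusion_system S).
Implicit Types (P Q R T : {group gT}) (f g h : gT -> gT) (a b : {perm gT}).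

(** Restricting a morphism or enlarging its target does not change the underlying
    function.  Fixing the target [S] and comparing functions only on [P] makes both
    operations invisible, so a single composition rule covers them. *)
Definition Fmor P f : Prop := frestr P f \in F P S.

(** Taking the generated subgroup makes [img] total; for a morphism [f] it is the
    plain image ([imgE]). *)
Definition img P f : {group gT} := generated_group (f @: P).

Definition Finv P f : gT -> gT := finvon P (frestr P f).

Lemma frestrE P f : {in P, frestr P f =1 f}.
Proof. by move=> x Px; rewrite ffunE Px. Qed.

Lemma frestr_out P f x : x \notin P -> frestr P f x = x.
Proof. by move=> Px; rewrite ffunE (negPf Px). Qed.

Lemma frestr_eq P f g : {in P, f =1 g} -> frestr P f = frestr P g.
Proof.
by move=> fg; apply/ffunP=> x; rewrite !ffunE; case: ifP => // Px; apply: fg.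
Qed.

Lemma frestr_imset P f : frestr P f @: P = f @: P.
Proof. by apply: eq_in_imset; exact: frestrE. Qed.

Lemma Fmor_eq P f g : {in P, f =1 g} -> Fmor P f -> Fmor P g.
Proof. by move=> fg; rewrite /Fmor (frestr_eq fg). Qed.

Lemma fhom_frestr P Q (f : {ffun gT -> gT}) : f \in F P Q -> frestr P f = f.
Proof.
case/fhom_sub=> _ _ [_ _ _ outf]; apply/ffunP=> x; rewrite ffunE.
by case: ifP => // /negbT Px; rewrite outf.
Qed.

Lemma Fmor_sub P f : Fmor P f -> P \subset S.
Proof. by case/fhom_sub. Qed.

Lemma Fmor_inj P f : Fmor P f -> {in P &, injective f}.
Proof.
case/fhom_sub=> _ _ [_ injf _ _] x y Px Py fxy.
by apply: injf; rewrite // !frestrE.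
Qed.

Lemma Fmor_morph P f : Fmor P f -> {in P &, {morph f : x y / x * y}}.
Proof.
case/fhom_sub=> _ _ [/morphicP fM _ _ _] x y Px Py.
by have := fM x y Px Py; rewrite !frestrE ?groupM.
Qed.

Lemma Fmor_imS P f : Fmor P f -> f @: P \subset S.
Proof. by case/fhom_sub=> _ _ [_ _]; rewrite frestr_imset. Qed.

Lemma FmorJ P f : Fmor P f -> {in P &, {morph f : x y / x ^ y}}.
Proof.
move=> Ff x y Px Py; have fM := Fmor_morph Ff.
apply: (mulgI (f y)); rewrite -fM ?groupJ // -conjgC fM //.
by rewrite -conjgC.
Qed.

Lemma Fmor_expg P f n x : Fmor P f -> x \in P -> f (x ^+ n) = f x ^+ n.
Proof.
move=> Ff Px; have fM := Fmor_morph Ff.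
elim: n => [|n IHn]; last by rewrite !expgS fM ?groupX ?IHn.
by apply: (mulgI (f x)); rewrite -fM ?expg0 // !mulg1.
Qed.

Lemma imgE P f : Fmor P f -> img P f = f @: P :> {set gT}.
Proof.
move=> Ff; apply/gen_set_id/group_setP; split=> [|_ _ /imsetP[x Px ->] /imsetP[y Py ->]].
  have f1 : f 1 = 1 by have := Fmor_expg 0 Ff (group1 P); rewrite !expg0.
  by rewrite -f1; apply: imset_f.
by rewrite -(Fmor_morph Ff) ?imset_f ?groupM.
Qed.

Lemma mem_img P f x : Fmor P f -> x \in P -> f x \in img P f.
Proof. by move=> Ff Px; rewrite imgE ?imset_f. Qed.

Lemma img_to P Q f : Fmor P f -> img P f = Q -> {in P, forall x, f x \in Q}.
Proof. by move=> Ff <- x; apply: mem_img. Qed.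

Lemma img_sub P f T : Fmor P f -> {in P, forall x, f x \in T} -> img P f \subset T.
Proof.
by move=> Ff fT; rewrite imgE //; apply/subsetP=> _ /imsetP[x Px ->]; apply: fT.
Qed.

Lemma imgS P f : Fmor P f -> img P f \subset S.
Proof. by move=> Ff; rewrite imgE // Fmor_imS. Qed.

Lemma img_eq P f g : {in P, f =1 g} -> img P f = img P g.
Proof. by move=> fg; apply: val_inj; rewrite /= (eq_in_imset fg). Qed.

Lemma card_img P f : Fmor P f -> #|img P f| = #|P|.
Proof. by move=> Ff; rewrite imgE // card_in_imset //; apply: Fmor_inj. Qed.

Lemma img_comp P f g : Fmor P f -> img P (g \o f) = img (img P f) g.
Proof.
move=> Ff; apply: val_inj; rewrite /= imset_comp.
by rewrite -{1}(imgE Ff).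
Qed.

Lemma Fmor_conj P x : P \subset S -> x \in S -> Fmor P (conjg^~ x).
Proof.
move=> sPS Sx; apply: fhom_conj => //.
by rewrite -(conjGid Sx) conjSg.
Qed.

Lemma Fmor_id P : P \subset S -> Fmor P id.
Proof.
by move=> sPS; apply: Fmor_eq (Fmor_conj sPS (group1 S)) => x _; rewrite conjg1.
Qed.

Lemma finvonK P (f : {ffun gT -> gT}) :
  {in P &, injective f} -> {in P, cancel f (finvon P f)}.
Proof.
move=> injf x Px; rewrite ffunE; case: pickP => [y /andP[Py /eqP]|/(_ x)] /=.
  exact: injf.
by rewrite Px eqxx.
Qed.

Lemma FinvK P f : Fmor P f -> {in P, cancel f (Finv P f)}.
Proof.
move=> Ff x Px; have := @finvonK P (frestr P f) _ x Px; rewrite frestrE //.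
by apply=> y z Py Pz; rewrite !frestrE //; apply: (Fmor_inj Ff).
Qed.

Lemma FinvKr P f : Fmor P f -> {in img P f, cancel (Finv P f) f}.
Proof.
by move=> Ff _ /[!imgE]// /imsetP[x Px ->]; rewrite FinvK.
Qed.

Lemma mem_Finv P f y : Fmor P f -> y \in img P f -> Finv P f y \in P.
Proof.
by move=> Ff /[!imgE]// /imsetP[x Px ->]; rewrite FinvK.
Qed.

Lemma Finv_fhom P f : Fmor P f -> finvon P (frestr P f) \in F (img P f) P.
Proof. by move=> Ff; apply: (fhom_inv Ff); rewrite frestr_imset (imgE Ff). Qed.

(** The axioms provide the corestriction of [f] to its image only through inverses:
    it is the inverse of the inverse of [f]. *)
Lemma Fmor_img P f : Fmor P f -> frestr P f \in F P (img P f).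
Proof.
move=> Ff; have := Finv_fhom Ff; set u := finvon P _ => Fu.
have uE y : u y = Finv P f y by [].
have uP: u @: img P f = P.
  apply/setP=> x; apply/imsetP/idP=> [[y Py ->]|Px].
    by rewrite uE mem_Finv.
  by exists (f x); rewrite ?mem_img // uE FinvK.
suff <- : finvon (img P f) u = frestr P f by apply: fhom_inv Fu uP.
apply/ffunP=> x.
have [Px|Px] := boolP (x \in P); last first.
  rewrite frestr_out // ffunE; case: pickP => //= y /andP[Py /eqP uyx].
  by rewrite -uyx uE mem_Finv in Px.
rewrite frestrE // -{1}(FinvK Ff Px) -uE finvonK ?mem_img //.
by move=> y z Py Pz /(congr1 f); rewrite !uE !FinvKr.
Qed.

Lemma fhom_weaken P Q R (f : {ffun gT -> gT}) :
  f \in F P Q -> Q \subset R -> R \subset S -> f \in F P R.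
Proof.
move=> Ff sQR sRS; have [sPS sQS [_ _ fPQ _]] := fhom_sub Ff.
have := fhom_conj F sQS sRS (group1 S); rewrite conjsg1 => /(_ sQR) Fi.
have := fhom_comp Ff Fi; congr (_ \in F P R); apply/ffunP=> x.
rewrite ffunE; case: ifP => [Px|/negbT Px] /=.
  by rewrite frestrE ?conjg1 // (subsetP fPQ) ?imset_f.
by rewrite -(fhom_frestr Ff) frestr_out.
Qed.

Lemma Fmor_fhom P Q f : Fmor P f -> Q \subset S -> f @: P \subset Q ->
  frestr P f \in F P Q.
Proof.
by move=> Ff sQS fPQ; apply: fhom_weaken (Fmor_img Ff) _ sQS; rewrite imgE.
Qed.

Lemma fhom_Fmor P Q (f : {ffun gT -> gT}) : f \in F P Q -> Fmor P f.
Proof.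
move=> Ff; rewrite /Fmor (fhom_frestr Ff).
by apply: (fhom_weaken Ff); case/fhom_sub: Ff.
Qed.

Lemma fcomp_frestr P Q f g : {in P, forall x, f x \in Q} ->
  fcomp P (frestr P f) (frestr Q g) = frestr P (g \o f).
Proof. by move=> fPQ; apply: frestr_eq => x Px /=; rewrite frestrE // frestrE ?fPQ. Qed.

Lemma Fmor_comp P Q f g : Fmor P f -> Fmor Q g -> {in P, forall x, f x \in Q} ->
  Fmor P (g \o f).
Proof.
move=> Ff Fg fPQ; rewrite /Fmor -(fcomp_frestr g fPQ).
apply: (fhom_comp _ Fg); apply: Fmor_fhom Ff (Fmor_sub Fg) _.
by apply/subsetP=> _ /imsetP[x Px ->]; apply: fPQ.
Qed.

Lemma Fmor_res P Q f : P \subset Q -> Fmor Q f -> Fmor P f.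
Proof.
move=> sPQ Ff; have sPS := subset_trans sPQ (Fmor_sub Ff).
by apply: (Fmor_comp (Fmor_id sPS) Ff) => x; apply: (subsetP sPQ).
Qed.

Lemma Fmor_inv P f : Fmor P f -> Fmor (img P f) (Finv P f).
Proof. by move=> Ff; apply: fhom_Fmor (Finv_fhom Ff). Qed.

Lemma img_inv P f : Fmor P f -> img (img P f) (Finv P f) = P.
Proof.
move=> Ff; rewrite -img_comp //; apply: val_inj; rewrite /= -[RHS]genGid.
congr (<<_>>); apply/setP=> x; apply/imsetP/idP => [[y Py ->]|Px].
  by rewrite /= FinvK.
by exists x; rewrite //= FinvK.
Qed.

Lemma img_id P : img P id = P.
Proof. by apply: val_inj; rewrite /= imset_id genGid. Qed.

Lemma AutF_Fmor P a : P \subset S -> a \in AutF F P -> Fmor P a.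
Proof. by move=> sPS /setIdP[_ Fa]; exact: fhom_weaken Fa sPS _. Qed.

Lemma AutF_mem P a x : a \in AutF F P -> x \in P -> a x \in P.
Proof. by case/setIdP=> Aa _; apply: Aut_closed. Qed.

Lemma AutF_img P a : P \subset S -> a \in AutF F P -> img P a = P.
Proof.
move=> sPS Aa; have Fa := AutF_Fmor sPS Aa; apply/val_inj/eqP.
rewrite [_ == _]eqEcard [#|val (img P a)|]card_img // leqnn andbT.
by apply: img_sub => // x; apply: AutF_mem.
Qed.

Lemma Fmor_AutF P f : Fmor P f -> {in P, forall x, f x \in P} ->
  exists2 a, a \in AutF F P & {in P, a =1 f}.
Proof.
move=> Ff fP; have sfP: f @: P \subset P.
  by apply/subsetP=> _ /imsetP[x Px ->]; apply: fP.
exists (perm_in (Fmor_inj Ff) sfP); last exact: perm_inE.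
apply/setIdP; split.
  rewrite inE perm_in_on; apply/morphicP=> x y Px Py.
  by rewrite !perm_inE ?groupM // (Fmor_morph Ff).
rewrite (frestr_eq (perm_inE _ _)); apply: Fmor_fhom sfP => //.
exact: Fmor_sub Ff.
Qed.

Lemma fclassP P Q :
  reflect (exists2 f, Fmor P f & img P f = Q) (Q \in fclass F P).
Proof.
rewrite inE; apply: (iffP exists_inP) => [[f Ff /eqP fP]|[f Ff <-]].
  have Ff' := fhom_Fmor Ff; exists f => //.
  by apply: val_inj; rewrite [LHS](imgE Ff') fP.
by exists (frestr P f); rewrite // frestr_imset (imgE Ff).
Qed.

Lemma fclass_img P f : Fmor P f -> img P f \in fclass F P.
Proof. by move=> Ff; apply/fclassP; exists f. Qed.

Lemma fclass_refl P : P \subset S -> P \in fclass F P.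
Proof. by move=> sPS; rewrite -{1}(img_id P) fclass_img //; apply: Fmor_id. Qed.

Lemma fclass_sym P Q : Q \in fclass F P -> P \in fclass F Q.
Proof.
by case/fclassP=> f Ff <-; rewrite -{1}(img_inv Ff); apply/fclass_img/Fmor_inv.
Qed.

Lemma fclass_trans P Q R : Q \in fclass F P -> R \in fclass F Q -> R \in fclass F P.
Proof.
case/fclassP=> f Ff <- /fclassP[g Fg <-]; rewrite -img_comp //.
by apply: fclass_img; apply: (Fmor_comp Ff Fg) => x; apply: (mem_img Ff).
Qed.

Lemma fclass_sub P Q : Q \in fclass F P -> Q \subset S.
Proof. by case/fclassP=> f Ff <-; apply: imgS. Qed.

Lemma fclass_card P Q : Q \in fclass F P -> #|Q| = #|P|.
Proof. by case/fclassP=> f Ff <-; apply: card_img. Qed.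

Lemma fcentricP P :
  reflect (P \subset S /\ {in fclass F P, forall Q : {group gT}, 'C_S(Q) \subset Q})
          (P \in fcentric F).
Proof.
rewrite inE; apply: (iffP andP) => [[-> /forall_inP cP]|[-> cP]]; split=> //.
by apply/forall_inP.
Qed.

Lemma fcentric_sub P : P \in fcentric F -> P \subset S.
Proof. by case/fcentricP. Qed.

Lemma fcentric_conj : conj_closed F (fcentric F).
Proof.
move=> P Q /fcentricP[sPS cP] PQ; apply/fcentricP; split; first exact: fclass_sub PQ.
by move=> R QR; apply: cP; apply: fclass_trans QR.
Qed.

(** A conjugate of [Q] contains a conjugate of [P], which contains its centralizer,
    and centralizers decrease. *)
Lemma fcentric_over P Q : P \in fcentric F -> P \subset Q -> Q \subset S ->
  Q \in fcentric F.
Proof.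
case/fcentricP=> sPS cP sPQ sQS; apply/fcentricP; split=> // R /fclassP[f Ff <-].
have FfP := Fmor_res sPQ Ff; have sfPQ: img P f \subset img Q f.
  by rewrite !imgE // imsetS.
apply: subset_trans sfPQ; apply: subset_trans (cP _ (fclass_img FfP)).
by rewrite setIS // centS // !imgE // imsetS.
Qed.

End Morphisms.

(** * The subgroup [Op'res] and strongly multiplicative maps *)

Section Op'residual.

Variables (aT : finGroupType) (p : nat).
Implicit Types (A H : {group aT}) (a : aT).

Lemma normal_p'index_p_elt A H a :
  H <| A -> p^'.-nat #|A : H| -> a \in A -> p.-elt a -> a \in H.
Proof.
move=> nHA p'AH Aa pa; have [sHA nHA'] := andP nHA.
have Na := subsetP nHA' a Aa.
apply: (coset_idr Na); apply/eqP; rewrite -order_eq1.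
have pca: p.-elt (coset H a) by apply: (morph_p_elt (coset_morphism H)).
have p'ca: p^'.-elt (coset H a).
  apply: mem_p_elt (mem_quotient H Aa); rewrite /pgroup card_quotient //.
by rewrite (pnat_1 pca p'ca).
Qed.

Lemma p_elt_Op'res A a : a \in A -> p.-elt a -> a \in Op'res p A.
Proof.
move=> Aa pa; apply/bigcapP=> H /andP[nHA p'AH].
exact: normal_p'index_p_elt nHA p'AH Aa pa.
Qed.

(** By Cauchy's theorem, if [p] divided the order of [A / H] then some element of
    order [p] of the quotient would lift to a [p]-element of [A] outside [H]. *)
Lemma Op'res_sub A H : prime p -> H <| A ->
  {in A, forall a, p.-elt a -> a \in H} -> Op'res p A \subset H.
Proof.
move=> p_pr nHA pH; apply: bigcap_inf; rewrite nHA /= p'natE //.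
rewrite -card_quotient ?normal_norm //; apply/negP=> /(Cauchy p_pr)[y AHy oy].
have [a Na Aa y_a] := morphimP AHy.
have py: p.-elt y by rewrite /p_elt oy pnat_id.
have: a.`_p \in H by rewrite pH ?groupX ?p_elt_constt.
move/coset_id; rewrite morph_constt // -y_a constt_p_elt // => y1.
by move: oy p_pr; rewrite y1 order1 => <-.
Qed.

Lemma ker_normal A (Gamma : groupType) (u : aT -> Gamma) :
    {in A &, {morph u : a b / a * b}} ->
  exists2 K : {group aT}, K <| A & forall a, (a \in K) = (a \in A) && (u a == 1).
Proof.
move=> uM; have u1: u 1 = 1 by apply: (mulgI (u 1)); rewrite -uM ?group1 ?mulg1.
pose K := [set a in A | u a == 1].
have gK: group_set K.
  apply/group_setP; split=> [|a b]; rewrite !inE ?group1 ?u1 ?eqxx //.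
  by case/andP=> Aa /eqP ua /andP[Ab /eqP ub]; rewrite groupM // uM // ua ub mulg1 /=.
exists (Group gK); last by move=> a; rewrite inE.
apply/andP; split; first by apply/subsetP=> a /setIdP[].
apply/subsetP=> b Ab; rewrite inE; apply/subsetP=> _ /imsetP[a /setIdP[Aa /eqP ua] ->].
rewrite !inE groupJ //= conjgE !uM ?groupM ?groupV // ua mul1g -uM ?groupV //.
by rewrite mulVg u1.
Qed.

(** Together with [p_elt_Op'res] this allows one to replace [Op'res p A] by the set of
    [p]-elements of [A] in the definition of strong multiplicativity. *)
Lemma Op'res_morph A (Gamma : groupType) (u : aT -> Gamma) : prime p ->
  {in A &, {morph u : a b / a * b}} -> {in A, forall a, p.-elt a -> u a = 1} ->
  {in Op'res p A, forall a, u a = 1}.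
Proof.
move=> p_pr uM pu; have [K nKA KE] := ker_normal uM.
have sOK: Op'res p A \subset K.
  by apply: Op'res_sub => // b Ab pb; rewrite KE Ab; apply/eqP/pu.
by move=> a /(subsetP sOK); rewrite KE => /andP[_ /eqP].
Qed.

End Op'residual.

Section StronglyMultiplicative.

Variables (gT : finGroupType) (S : {group gT}) (F : fusion_system S) (p : nat).
Variable Gamma : groupType.
Implicit Types (C : {set {group gT}}) (P Q R T : {group gT}).
Implicit Types (f g h : gT -> gT) (a b : {perm gT}).
Implicit Types t : {group gT} -> (gT -> gT) -> Gamma.

(** Taking [f] to be the identity of [P] in [mult_comp] gives invariance under
    restriction and the value 1 on inclusions ([mult_id], [mult_res]). *)
Record mult C t : Prop := Mult {
  mult_eq : forall P f g, P \in C -> Fmor F P f -> {in P, f =1 g} -> t P f = t P g;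
  mult_comp : forall P Q f g, P \in C -> Q \in C -> Fmor F P f -> Fmor F Q g ->
    {in P, forall x, f x \in Q} -> t P (g \o f) = t P f * t Q g
}.

(** Being a [p]-element is preserved by conjugation, which makes this form of strong
    multiplicativity easy to carry along a conjugacy class. *)
Record smult C t : Prop := Smult {
  smult_mult :> mult C t;
  smult_p_elt : forall P a, P \in C -> a \in AutF F P -> p.-elt a -> t P a = 1
}.

(** No information is lost: inclusions have value 1, so a multiplicative map does not
    depend on the target ([mult_untarget]). *)
Definition untarget (theta : mor_map gT Gamma) P f : Gamma := theta P S (frestr P f).

Lemma mult_id C t P : mult C t -> P \in C -> P \subset S -> t P id = 1.
Proof.
move=> [_ tM] CP sPS; have Fi := Fmor_id F sPS.
by apply: (mulgI (t P id)); rewrite -(tM P P id id) ?mulg1.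
Qed.

Lemma mult_res C t P Q f : mult C t -> P \in C -> Q \in C -> P \subset Q ->
  Fmor F Q f -> t P f = t Q f.
Proof.
move=> tP CP CQ sPQ Ff; have sPS := subset_trans sPQ (Fmor_sub Ff).
have /= := mult_comp tP CP CQ (Fmor_id F sPS) Ff (subsetP sPQ).
by rewrite (mult_id tP) // mul1g.
Qed.

Lemma AutF_morph C t P : P \subset S -> P \in C -> mult C t ->
  {in AutF F P &, {morph (fun a => t P a) : a b / a * b}}.
Proof.
move=> sPS CP tP a b Aa Ab; have Fa := AutF_Fmor sPS Aa; have Fb := AutF_Fmor sPS Ab.
have aP x: x \in P -> a x \in P by apply: (AutF_mem Aa).
rewrite -(mult_comp tP) //; apply: (mult_eq tP) => // [|x Px]; last by rewrite permM.
by apply: Fmor_eq (Fmor_comp Fa Fb aP) => x Px; rewrite permM.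
Qed.

Lemma mult_untarget C theta : S \in C -> multiplicative_map F C theta ->
  mult C (untarget theta) /\
  forall P Q (f : {ffun gT -> gT}), P \in C -> Q \in C -> f \in F P Q ->
    theta P Q f = untarget theta P f.
Proof.
move=> CS [tM t1]; split; first split=> [P f g _ _ fg|P Q f g CP CQ Ff Fg fPQ].
- by rewrite /untarget (frestr_eq fg).
- have [sPS sQS] := (Fmor_sub Ff, Fmor_sub Fg).
  have fPQ': f @: P \subset Q by apply/subsetP=> _ /imsetP[x Px ->]; apply: fPQ.
  have Ff' := Fmor_fhom Ff sQS fPQ'.
  have Fi := Fmor_id F sQS.
  rewrite /untarget -(fcomp_frestr g fPQ) (tM P Q S) //; congr (_ * _).
  by rewrite -[LHS]mulg1 -(t1 Q S) // -tM // fcomp_frestr.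
move=> P Q f CP CQ Ff.
rewrite /untarget (fhom_frestr Ff); have [_ sQS [_ _ fPQ _]] := fhom_sub Ff.
have Fi := Fmor_id F sQS; rewrite -[LHS]mulg1 -(t1 Q S) // -tM //.
congr (theta P S _); rewrite -{1}(fhom_frestr Ff) fcomp_frestr ?(fhom_frestr Ff) //.
by move=> x Px; rewrite (subsetP fPQ) ?imset_f.
Qed.

Lemma untarget_AutF theta P a : untarget theta P (frestr P a) = untarget theta P a.
Proof. by congr (theta P S _); apply: frestr_eq => x Px; rewrite frestrE. Qed.

Lemma smult_untarget C theta : C \subset fcentric F -> S \in C ->
  strongly_multiplicative F p C theta -> smult C (untarget theta).
Proof.
move=> sCc CS [thM thS]; have [uM uE] := mult_untarget CS thM; split=> // P a CP Aa pa.
have sPS := fcentric_sub (subsetP sCc P CP).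
rewrite -untarget_AutF -(uE P P) //; last by case/setIdP: Aa.
by apply: thS CP _; apply: (@p_elt_Op'res _ _ (Group (AutF_group_set F sPS))).
Qed.

End StronglyMultiplicative.

(** * Consequences of saturation *)

Section Saturated.

Variables (gT : finGroupType) (S : {group gT}) (F : fusion_system S) (p : nat).
Hypotheses (pS : p.-group S) (satF : fsaturated F p).
Implicit Types (C : {set {group gT}}) (P Q R T : {group gT}).
Implicit Types (f h : gT -> gT) (a b : {perm gT}).

Lemma ex_fully_normalized P : P \subset S ->
  exists2 Q : {group gT}, Q \in fclass F P & fully_normalized F Q.
Proof.
move=> sPS; have PP := fclass_refl F sPS.
case: (arg_maxnP (fun Q : {group gT} => #|'N_S(Q)|) PP) => Q PQ maxQ.
exists Q => //; split; first exact: fclass_sub PQ.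
by move=> R QR; apply/maxQ/(fclass_trans PQ QR).
Qed.

Lemma fully_normalized_centralized P : fully_normalized F P -> fully_centralized F P.
Proof. by case: satF => sat1 _ /sat1[]. Qed.

Lemma fully_normalized_Sylow P : fully_normalized F P -> p.-Sylow(AutF F P) (AutS S P).
Proof. by case: satF => sat1 _ /sat1[]. Qed.

Lemma AutSP P a :
  reflect (exists2 x, x \in 'N_S(P) & a = conj_aut P x) (a \in AutS S P).
Proof.
apply: (iffP morphimP) => [[x Nx Sx ->]|[x Sx ->]]; first by exists x.
by exists x => //; case/setIP: Sx.
Qed.

Lemma AutS_p_elt P a : a \in AutS S P -> p.-elt a.
Proof.
apply: mem_p_elt; apply: morphim_pgroup; apply: pgroupS pS; exact: subsetIl.
Qed.

Lemma AutS_AutF P a : P \subset S -> a \in AutS S P -> a \in AutF F P.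
Proof.
move=> sPS /AutSP[x /setIP[Sx Nx] ->].
have cE := norm_conj_autE Nx.
have [||b Ab bE] := @Fmor_AutF _ _ F P (conjg^~ x).
- exact: Fmor_conj.
- by move=> y Py; rewrite memJ_norm.
suff -> : conj_aut P x = b by [].
apply: (@eq_Aut _ P) => [||y Py]; last by rewrite cE // bE.
  exact: Aut_aut.
by case/setIdP: Ab.
Qed.

Lemma p_elt_AutF P a n : a \in AutF F P -> p.-nat n -> {in P, a ^+ n =1 id} ->
  p.-elt a.
Proof.
case/setIdP=> Aa _ pn an; apply: (pnat_dvd _ pn); rewrite order_dvdn.
by apply/eqP/(@eq_Aut _ P) => [||x Px]; rewrite ?groupX ?group1 // perm1 an.
Qed.

(** Saturation in the form used below: it is enough to check, for each [g] in [T],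
    that conjugation by [g] is carried into [AutS S Q]. *)
Lemma extend_over P Q T f : Fmor F P f -> img P f = Q -> fully_centralized F Q ->
    P \subset T -> T \subset 'N_S(P) ->
    (forall g, g \in T ->
      exists2 b, b \in AutS S Q & {in P, forall x, f (x ^ g) = b (f x)}) ->
  exists2 h, Fmor F T h & {in P, h =1 f}.
Proof.
move=> Ff fPQ cQ sPT sTN fT; case: satF => _ sat2.
have Ff' : frestr P f \in F P Q by rewrite -fPQ; apply: Fmor_img.
have fP' : frestr P f @: P = Q by rewrite frestr_imset -fPQ (imgE Ff).
have [h Fh hE] := sat2 P Q _ Ff' fP' cQ.
have sTNphi: T \subset [group of Nphi S P Q (frestr P f)].
  apply/subsetP=> g Tg; apply/setIdP; split; first exact: (subsetP sTN).
  have [b Ab bE] := fT g Tg; apply/exists_inP; exists b => //.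
  apply/forall_inP=> x Px; have Nx: g \in 'N(P) by case/setIP: (subsetP sTN g Tg).
  by rewrite !frestrE ?memJ_norm // bE.
exists h; first exact: Fmor_res sTNphi (fhom_Fmor Fh).
by move=> x Px; rewrite hE // frestrE.
Qed.

Lemma img_norm P T f : P \subset T -> T \subset 'N(P) -> Fmor F T f ->
  img T f \subset 'N_S(img P f).
Proof.
move=> sPT nPT Ff; have FfP := Fmor_res sPT Ff.
rewrite subsetI (imgS Ff); apply: (img_sub Ff) => x Tx.
rewrite inE (imgE FfP); apply/subsetP=> _ /imsetP[_ /imsetP[y Py ->] ->].
have Ty := subsetP sPT y Py.
by rewrite -(FmorJ Ff) // imset_f // memJ_norm // (subsetP nPT).
Qed.

(** An extension [h] of [f] shows that [f] carries conjugation by [x] to conjugation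
    by [h x], so every extension lives on a subgroup of [Nphi]; hence two extensions
    can be compared through a third one defined on all of [Nphi]. *)
Lemma sub_Nphi P T f h : Fmor F P f -> P \subset T -> T \subset 'N_S(P) ->
  Fmor F T h -> {in P, h =1 f} -> T \subset Nphi S P (img P f) (frestr P f).
Proof.
move=> Ff sPT sTN Fh hf; apply/subsetP=> x Tx; apply/setIdP.
have nPT : T \subset 'N(P) by apply: subset_trans sTN (subsetIr _ _).
split; first exact: (subsetP sTN).
have Nhx := subsetP (img_norm sPT nPT Fh) _ (mem_img Fh Tx).
rewrite (img_eq hf) in Nhx.
apply/exists_inP; exists (conj_aut (img P f) (h x)); first by apply/AutSP; exists (h x).
apply/forall_inP=> y Py; have [_ nfP] := setIP Nhx.
have Pyx : y ^ x \in P by rewrite memJ_norm // (subsetP nPT).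
rewrite !frestrE // norm_conj_autE ?(mem_img Ff) //.
by rewrite -!hf // (FmorJ Fh) // (subsetP sPT).
Qed.

(** Any isomorphism [phi] from [Q] to [P] carries [AutS S Q] to a [p]-subgroup of
    [AutF F P].  By Sylow's theorem a further automorphism [chi] of [P] moves it into
    [AutS S P], after which all of ['N_S(Q)] satisfies the extension condition. *)
Lemma transporter P Q : fully_normalized F P -> Q \in fclass F P ->
  exists2 h, Fmor F 'N_S(Q) h & img Q h = P.
Proof.
move=> nP PQ; have [sPS _] := nP; have sQS := fclass_sub PQ.
have /fclassP[phi Fphi phiP] := fclass_sym PQ.
pose A := Group (AutF_group_set F sPS).
(* [B] is the image of [AutS S Q] under transport by [phi]: the automorphisms of
   [P] that correspond to conjugation by some [g] in ['N_S(Q)]. *)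
pose compat b g := [forall x in Q, b (phi x) == phi (x ^ g)].
pose B := [set b in A | [exists g in 'N_S(Q), compat b g]].
have memphi x : x \in Q -> phi x \in P by rewrite -phiP; apply: (mem_img Fphi).
have gB : group_set B.
  apply/group_setP; split=> [|b c].
    rewrite inE group1; apply/exists_inP; exists 1; rewrite ?group1 //.
    by apply/forall_inP=> x _; rewrite perm1 conjg1.
  case/setIdP=> Ab /exists_inP[g Ng /forall_inP bE].
  case/setIdP=> Ac /exists_inP[k Nk /forall_inP cE].
  rewrite inE groupM //; apply/exists_inP; exists (g * k); first exact: groupM.
  apply/forall_inP=> x Qx; have Qxg: x ^ g \in Q by rewrite memJ_norm //; case/setIP: Ng.
  by rewrite permM (eqP (bE x Qx)) (eqP (cE _ Qxg)) conjgM.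
have compatX b g n : b \in A -> g \in 'N_S(Q) -> compat b g -> compat (b ^+ n) (g ^+ n).
  move=> Ab Ng /forall_inP bE; elim: n => [|n /forall_inP IHn].
    by apply/forall_inP=> x _; rewrite perm1 conjg1.
  apply/forall_inP=> x Qx; rewrite !expgSr permM (eqP (IHn x Qx)).
  rewrite conjgM (eqP (bE _ _)) // memJ_norm // groupX //; by case/setIP: Ng.
have pB : p.-group (Group gB).
  apply/pgroupP=> q q_pr /(Cauchy q_pr)[b /setIdP[Ab /exists_inP[g Ng bg]] ob].
  have pb: p.-elt b.
    apply: (@p_elt_AutF P _ #[g]) => // [|y].
      by apply: mem_p_elt pS _; case/setIP: Ng.
    rewrite -phiP => Py; have /forall_inP := compatX b g #[g] Ab Ng bg.
    move/(_ _ (mem_Finv Fphi Py)); rewrite expg_order conjg1 (FinvKr Fphi) //.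
    by move/eqP.
  by move: pb; rewrite /p_elt ob => /(pnatPpi); apply; rewrite pi_of_prime // inE.
have sBA: Group gB \subset A by apply/subsetP=> b /setIdP[].
have [chi Achi sBchi] := Sylow_subJ (fully_normalized_Sylow nP : p.-Sylow(A) _) sBA pB.
have AchiV : chi^-1 \in A by rewrite groupV.
have Fchi := AutF_Fmor sPS AchiV.
have Ff := Fmor_comp Fphi Fchi memphi.
have fQP : img Q (chi^-1 \o phi) = P by rewrite (img_comp _ Fphi) phiP (@AutF_img _ _ F _ _ sPS AchiV).
have cP := fully_normalized_centralized nP.
have sQN: Q \subset 'N_S(Q) by rewrite subsetI sQS normG.
have [g Ng|h Fh hE] := extend_over Ff fQP cP sQN (subxx _).
  have nQg : g \in 'N(Q) by case/setIP: Ng.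
  have Fg: Fmor F P (phi \o (conjg^~ g \o Finv Q phi)).
    have Sg: g \in S by case/setIP: Ng.
    rewrite -phiP; apply: (Fmor_comp (Fmor_comp (Fmor_inv Fphi) (Fmor_conj F sQS Sg) _) Fphi).
      by move=> y; apply: (mem_Finv Fphi).
    by move=> y Py /=; rewrite memJ_norm // (mem_Finv Fphi).
  have [|b Ab bE] := Fmor_AutF Fg.
    move=> y; rewrite -{1}phiP => Py /=.
    by rewrite memphi // memJ_norm // (mem_Finv Fphi).
  have Bb : b \in Group gB.
    rewrite inE Ab; apply/exists_inP; exists g => //; apply/forall_inP=> x Qx.
    by rewrite bE ?memphi //= (FinvK Fphi).
  have := subsetP sBchi b Bb; rewrite mem_conjg => Abchi.
  exists (b ^ chi^-1) => // x Qx.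
  by rewrite [b ^ _]conjgE invgK !permM /= permKV bE ?memphi //= (FinvK Fphi).
exists h => //; rewrite -fQP; apply: img_eq => x Qx; exact: hE.
Qed.

Lemma conj_aut_AutF P a x : P \subset S -> a \in AutF F P -> x \in P ->
  conj_aut P x ^ a = conj_aut P (a x).
Proof.
move=> sPS Aa Px; have Pax := AutF_mem Aa Px; have [AAa _] := setIdP Aa.
apply: (@eq_Aut _ P) => [||y Py]; rewrite ?groupJ ?Aut_aut //.
have Py' : (a^-1)%g y \in P by apply: Aut_closed Py; rewrite groupV.
rewrite conjgE !permM !conj_autE // (FmorJ (AutF_Fmor sPS Aa)) //.
by rewrite permKV.
Qed.

Lemma Inn_normal P (sPS : P \subset S) :
  [group of Inn P] <| Group (AutF_group_set F sPS).
Proof.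
apply/andP; split.
  apply/subsetP=> _ /morphimP[x Nx Px ->]; apply: AutS_AutF => //.
  by apply/AutSP; exists x; rewrite // inE Nx (subsetP sPS).
apply/subsetP=> a Aa; rewrite inE.
apply/subsetP=> _ /imsetP[_ /morphimP[x _ Px ->] ->].
have Pax := AutF_mem Aa Px.
by rewrite (conj_aut_AutF sPS Aa) // mem_morphim // (subsetP (normG P)).
Qed.

(** [T] is the preimage of ['O_p(AutF F P)] under the conjugation action.  That core
    is contained in the Sylow subgroup [AutS S P], so it is realized by elements of
    ['N_S(P)]; it is normal in [AutF F P], so every automorphism satisfies the
    extension condition on [T] and its extension maps [T] to itself; and it is larger
    than [Inn P] because [P] is not radical. *)
Lemma nonradical_ext P : fully_normalized F P -> ~~ fradical F p P ->
  exists T : {group gT}, [/\ P \proper T, T \subset 'N_S(P)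
    & {in AutF F P, forall a,
        exists f, [/\ Fmor F T f, {in P, f =1 a} & img T f = T]}].
Proof.
move=> nP nradP; have [sPS _] := nP.
pose A := Group (AutF_group_set F sPS); pose K := 'O_p(A).
have sylA : p.-Sylow(A) (AutS S P) := fully_normalized_Sylow nP.
have sKS : K \subset AutS S P := pcore_sub_Hall sylA.
have sPN : P \subset 'N_S(P) by rewrite subsetI sPS normG.
have nInn : [group of Inn P] <| A := Inn_normal sPS.
have pInn : p.-group [group of Inn P] by apply: morphim_pgroup; apply: pgroupS pS.
have sInnK : Inn P \subset K by apply: pcore_max.
pose T := ('N_S(P) :&: conj_aut P @*^-1 K)%G.
have sTN : T \subset 'N_S(P) by apply: subsetIl.
have sPT : P \subset T.
  rewrite subsetI sPN; apply: subset_trans (morphpreS _ sInnK).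
  by rewrite morphimK ?normG // mulG_subr.
have pPT : P \proper T.
  rewrite properE sPT; apply: contra nradP => sTP; rewrite /fradical.
  (* If [T] were [P], every element of the core would be inner, and then
     ['O_p(OutF F P)] would be trivial. *)
  have KI : K = Inn P.
    apply/eqP; rewrite eqEsubset sInnK andbT; apply/subsetP=> k Kk.
    have /AutSP[g Ng kE] := subsetP sKS k Kk; have [_ nPg] := setIP Ng.
    rewrite kE mem_morphim //; apply/(subsetP sTP)/setIP; split=> //.
    by apply/morphpreP; split=> //; move: Kk; rewrite {1}kE.
  have := pquotient_pcore nInn pInn; rewrite -/K KI /OutF => ->.
  by rewrite trivg_quotient.
exists T; split=> // a Aa.
have Fa := AutF_Fmor sPS Aa.
have conjT g : g \in T -> conj_aut P g ^ a \in K.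
  case/setIP=> _ /morphpreP[_ Kg]; rewrite memJ_norm //.
  by apply: (subsetP (normal_norm (pcore_normal p A))).
have conjTE g x : g \in T -> x \in P -> a (x ^ g) = (conj_aut P g ^ a) (a x).
  move=> /(subsetP sTN)/setIP[_ nPg] Px; rewrite conjgE !permM permK.
  by rewrite norm_conj_autE.
have [g Tg|f Ff fE] := extend_over Fa (AutF_img sPS Aa) (fully_normalized_centralized nP) sPT sTN.
  by exists (conj_aut P g ^ a); [apply/(subsetP sKS)/conjT | move=> x; apply: conjTE].
have fPP : img P f = P by rewrite (img_eq fE) (AutF_img sPS Aa).
exists f; split=> //; apply/val_inj/eqP.
rewrite [_ == _]eqEcard [#|val (img T f)|](card_img Ff) leqnn andbT.
have nPT : T \subset 'N(P) by apply: subset_trans sTN (subsetIr _ _).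
have sfN := img_norm sPT nPT Ff; rewrite fPP in sfN.
apply: (img_sub Ff) => g Tg; have Nfg := subsetP sfN _ (mem_img Ff Tg).
have [Sfg nPfg] := setIP Nfg; apply/setIP; split=> //; apply/morphpreP; split=> //.
suff cfE : conj_aut P (f g) = conj_aut P g ^ a by have := conjT g Tg; rewrite -cfE.
have AAa : a \in Aut P by case/setIdP: Aa.
apply: (@eq_Aut _ P) => [||y Py]; rewrite ?groupJ ?Aut_aut //.
have: y \in img P a by rewrite (AutF_img sPS Aa).
rewrite (imgE Fa) => /imsetP[x Px ->]; rewrite norm_conj_autE ?(AutF_mem Aa) //.
rewrite -conjTE // -!fE ?memJ_norm ?(subsetP nPT) // (FmorJ Ff) //.
exact: (subsetP sPT).
Qed.

Lemma smult_conj C (Gamma : groupType) (t : {group gT} -> (gT -> gT) -> Gamma) T x :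
  smult F p C t -> T \in C -> x \in 'N_S(T) -> T \subset S -> t T (conjg^~ x) = 1.
Proof.
move=> tC CT Nx sTS; have [Sx nTx] := setIP Nx.
have Ax : conj_aut T x \in AutS S T by apply/AutSP; exists x.
rewrite -(smult_p_elt tC CT (AutS_AutF sTS Ax)) ?(AutS_p_elt Ax) //.
apply: (mult_eq tC) => //; first exact: Fmor_conj.
by move=> y Ty; rewrite norm_conj_autE.
Qed.

(** For [x] in [T], [h x] and [f x] act in the same way on the image of [P], so they
    differ by an element of that image, [P] being centric.  Thus [h] is [f] precomposed
    with an automorphism [a] of [T] that moves each [x] to [z * x] with [z] in [P]
    fixed by [a]; such an [a] has order dividing [#|P|]. *)
Lemma smult_agree C (Gamma : groupType) (t : {group gT} -> (gT -> gT) -> Gamma)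
    P T f h :
  smult F p C t -> P \in fcentric F -> P \subset T -> T \subset 'N(P) -> T \in C ->
  Fmor F T f -> Fmor F T h -> {in P, f =1 h} -> t T f = t T h.
Proof.
move=> tP /fcentricP[sPS cP] sPT nPT CT Ff Fh fh.
have FfP := Fmor_res sPT Ff; have cfP := cP _ (fclass_img FfP).
have hE x : x \in T -> exists2 z, z \in P & h x = f (z * x).
  move=> Tx; have w_fP : h x * (f x)^-1 \in img P f.
    have Sfx := subsetP (imgS Ff) _ (mem_img Ff Tx).
    have Shx := subsetP (imgS Fh) _ (mem_img Fh Tx).
    apply: (subsetP cfP); apply/setIP; split; first by rewrite groupM ?groupV.
    apply/centP=> y'; rewrite (imgE FfP) => /imsetP[y Py ->{y'}].
    have Ty := subsetP sPT y Py.
    have Pyx : y ^ x \in P by rewrite memJ_norm // (subsetP nPT).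
    apply/esym/commgP/conjg_fixP; rewrite conjgM {1}fh // -(FmorJ Fh) //.
    by rewrite -fh // (FmorJ Ff) // conjgK.
  exists (Finv P f (h x * (f x)^-1)); first exact: (mem_Finv FfP).
  rewrite (Fmor_morph Ff) ?(FinvKr FfP) ?mulgKV //.
  by rewrite (subsetP sPT) ?(mem_Finv FfP).
have hT x : x \in T -> h x \in img T f.
  move=> Tx; have [z Pz ->] := hE x Tx.
  by rewrite (mem_img Ff) // groupM // (subsetP sPT).
have Fa : Fmor F T (Finv T f \o h) by apply: Fmor_comp Fh (Fmor_inv Ff) hT.
have [|a Aa aE] := Fmor_AutF Fa.
  by move=> x Tx; apply: (mem_Finv Ff); apply: hT.
have sTS := Fmor_sub Ff; have aT x : x \in T -> a x \in T by apply: (AutF_mem Aa).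
have aP z : z \in P -> a z = z.
  by move=> Pz; have Tz := subsetP sPT z Pz; rewrite aE //= -fh // (FinvK Ff).
have pa : p.-elt a.
  apply: (p_elt_AutF Aa (pgroupS sPS pS)) => x Tx.
  have [z Pz zE] := hE x Tx; have Tz := subsetP sPT z Pz.
  have axE : a x = z * x by rewrite aE //= zE (FinvK Ff) ?groupM.
  suff aX n : (a ^+ n) x = z ^+ n * x by rewrite aX (expg_cardG Pz) mul1g.
  elim: n => [|n IHn]; first by rewrite perm1 mul1g.
  rewrite expgSr permM IHn (Fmor_morph (AutF_Fmor sTS Aa)) ?groupX //.
  by rewrite aP ?groupX // axE mulgA -expgSr.
have Fa' := AutF_Fmor sTS Aa.
have hfa : {in T, h =1 f \o a} by move=> x Tx; rewrite /= aE //= (FinvKr Ff) // hT.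
rewrite [RHS](mult_eq tP CT Fh hfa) (mult_comp tP CT CT Fa' Ff aT).
by rewrite (smult_p_elt tP CT Aa pa) mul1g.
Qed.

End Saturated.

(** * Extending a strongly multiplicative map to all centric subgroups *)

Section ExtendStep.

Variables (gT : finGroupType) (S : {group gT}) (F : fusion_system S) (p : nat).
Hypotheses (pS : p.-group S) (satF : fsaturated F p).
Variables (Gamma : groupType) (C : {set {group gT}}).
Variable t : {group gT} -> (gT -> gT) -> Gamma.
Implicit Types (Q R T M : {group gT}) (f h k : gT -> gT) (a b : {perm gT}).

Hypotheses (sCc : C \subset fcentric F) (conjC : conj_closed F C) (tC : smult F p C t).
Variable P : {group gT}.
Hypotheses (nP : fully_normalized F P) (cP : P \in fcentric F).
Hypotheses (nradP : ~~ fradical F p P) (notCP : P \notin C).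
Hypothesis bigC : forall T, T \in fcentric F -> #|P| < #|T| -> T \in C.

Let sPS : P \subset S := fcentric_sub cP.
Let cl := fclass F P.

Let img_C Q f : Q \in C -> Fmor F Q f -> img Q f \in C.
Proof. by move=> CQ Ff; apply: conjC CQ (fclass_img Ff). Qed.

Let C_sub Q : Q \in C -> Q \subset S.
Proof. by move/(subsetP sCc)/fcentric_sub. Qed.

Let overC Q T : Q \in cl -> Q \proper T -> T \subset S -> T \in C.
Proof.
move=> clQ QT sTS; have cQ := fcentric_conj cP clQ.
apply: bigC; first exact: fcentric_over cQ (proper_sub QT) sTS.
by rewrite -(fclass_card clQ) proper_card.
Qed.

(** Both domains lie in [Nphi], and saturation provides an extension [k] of [f] there;
    [smult_agree] compares [k] with each of the two given extensions. *)
Lemma extension_val_unique f T1 T2 h1 h2 : Fmor F P f -> img P f = P ->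
  P \proper T1 -> T1 \subset 'N_S(P) -> Fmor F T1 h1 -> {in P, h1 =1 f} ->
  P \proper T2 -> T2 \subset 'N_S(P) -> Fmor F T2 h2 -> {in P, h2 =1 f} ->
  t T1 h1 = t T2 h2.
Proof.
move=> Ff fP pT1 sT1 Fh1 h1E pT2 sT2 Fh2 h2E; case: satF => _ sat2.
have cfP : fully_centralized F (img P f) by rewrite fP; apply: (fully_normalized_centralized satF).
have fPE : frestr P f @: P = img P f by rewrite frestr_imset (imgE Ff).
have [k Fk kE] := sat2 _ _ _ (Fmor_img Ff) fPE cfP.
move/fhom_Fmor: Fk kE; set M := [group of _] => Fk kE.
have sT1M : T1 \subset M := sub_Nphi Ff (proper_sub pT1) sT1 Fh1 h1E.
have sT2M : T2 \subset M := sub_Nphi Ff (proper_sub pT2) sT2 Fh2 h2E.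
have CM : M \in C.
  by apply: (overC (fclass_refl F sPS)) (Fmor_sub Fk); apply: proper_sub_trans sT1M.
have tkE T h : P \proper T -> T \subset 'N_S(P) -> T \subset M -> Fmor F T h ->
    {in P, h =1 f} -> t T h = t M k.
  move=> pT sTN sTM Fh hE; have [sTS nPT] := subsetIP sTN.
  have CT : T \in C by apply: (overC (fclass_refl F sPS)).
  rewrite -(mult_res tC CT CM sTM Fk).
  apply: (smult_agree pS tC cP (proper_sub pT)) => //; first exact: Fmor_res Fk.
  by move=> x Px; rewrite hE // kE // frestrE.
by rewrite (tkE T1) // (tkE T2).
Qed.

Lemma ex_aut_val : exists v : (gT -> gT) -> Gamma,
  forall f, Fmor F P f -> img P f = P -> forall T h, P \proper T -> T \subset 'N_S(P) ->
    Fmor F T h -> {in P, h =1 f} -> v f = t T h.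
Proof.
have [T0 [pT0 sT0 T0E]] := nonradical_ext pS satF nP nradP.
have : forall f, exists c, Fmor F P f -> img P f = P -> forall T h, P \proper T ->
    T \subset 'N_S(P) -> Fmor F T h -> {in P, h =1 f} -> c = t T h.
  move=> f; have [[Ff fP]|nFf] := pselect (Fmor F P f /\ img P f = P); last first.
    by exists 1 => Ff fP; case: nFf.
  have [|a Aa aE] := Fmor_AutF Ff; first by exact: img_to Ff fP.
  have [h0 [Fh0 h0E _]] := T0E a Aa; exists (t T0 h0) => _ _ T h pT sT Fh hE.
  by apply: (extension_val_unique Ff) => // x Px; rewrite h0E // aE.
by case/choice=> v vE; exists v.
Qed.

Variable v : (gT -> gT) -> Gamma.
Hypothesis vE : forall f, Fmor F P f -> img P f = P -> forall T h, P \proper T ->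
  T \subset 'N_S(P) -> Fmor F T h -> {in P, h =1 f} -> v f = t T h.

Lemma ex_ext f : Fmor F P f -> img P f = P -> exists T k,
  [/\ P \proper T, T \subset 'N_S(P), Fmor F T k, {in P, k =1 f} & v f = t T k].
Proof.
have [T [pT sT TE]] := nonradical_ext pS satF nP nradP.
move=> Ff fP; have [|a Aa aE] := Fmor_AutF Ff.
  by exact: img_to Ff fP.
have [k [Fk kE _]] := TE a Aa; exists T, k.
have kf : {in P, k =1 f} by move=> x Px; rewrite kE // aE.
by split=> //; apply: vE.
Qed.

Lemma v_eq f h : Fmor F P f -> img P f = P -> {in P, f =1 h} -> v f = v h.
Proof.
move=> Ff fP fh; have [T [k [pT sT Fk kE ->]]] := ex_ext Ff fP.
apply/esym/vE => //; first exact: Fmor_eq Ff.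
  by rewrite -(img_eq fh).
by move=> x Px; rewrite kE // fh.
Qed.

Lemma v_comp f h : Fmor F P f -> img P f = P -> Fmor F P h -> img P h = P ->
  v (h \o f) = v f * v h.
Proof.
have [T [pT sT TE]] := nonradical_ext pS satF nP nradP.
have autP u : Fmor F P u -> img P u = P -> exists k,
    [/\ Fmor F T k, {in P, k =1 u}, img T k = T & v u = t T k].
  move=> Fu uP; have [|a Aa aE] := Fmor_AutF Fu.
    by exact: img_to Fu uP.
  have [k [Fk kE kT]] := TE a Aa.
  have ku : {in P, k =1 u} by move=> x Px; rewrite kE // aE.
  by exists k; split=> //; apply: vE.
move=> Ff fP Fh hP; have [k1 [Fk1 k1E k1T ->]] := autP f Ff fP.
have [k2 [Fk2 k2E k2T ->]] := autP h Fh hP.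
have [sTS _] := subsetIP sT; have CT : T \in C by apply: (overC (fclass_refl F sPS)).
have k1TT x : x \in T -> k1 x \in T by apply: (img_to Fk1 k1T).
have fPP x : x \in P -> f x \in P by apply: (img_to Ff fP).
rewrite -(mult_comp tC CT CT Fk1 Fk2 k1TT); apply: vE => //.
- exact: Fmor_comp Ff Fh fPP.
- by rewrite (img_comp _ Ff) fP.
- exact: Fmor_comp Fk1 Fk2 k1TT.
by move=> x Px; rewrite /= k1E // k2E // fPP.
Qed.

Let pNP : P \proper 'N_S(P).
Proof.
have [T [pT sT _]] := nonradical_ext pS satF nP nradP.
exact: proper_sub_trans pT sT.
Qed.

(** On [AutS S P] the value is 1, as conjugation by [x] extends to ['N_S(P)] as an
    automorphism of [p]-power order.  Every [p]-element is conjugate into this Sylow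
    subgroup, and the value 1 is invariant under conjugation. *)
Lemma v_p_elt a : a \in AutF F P -> p.-elt a -> v a = 1.
Proof.
pose A := Group (AutF_group_set F sPS).
have AP b : b \in A -> Fmor F P b /\ img P b = P.
  by move=> Ab; rewrite (@AutF_img _ _ F _ b) //; split=> //; apply: AutF_Fmor.
have vM : {in A &, forall b c, v (b * c) = v b * v c}.
  move=> b c Ab Ac; have [[Fb bP] [Fc cP']] := (AP b Ab, AP c Ac).
  have [Fbc bcP] := AP (b * c) (groupM Ab Ac).
  by rewrite -v_comp //; apply: v_eq => // x _; rewrite permM.
move=> Aa pa; have sylA : p.-Sylow(A) (AutS S P) := fully_normalized_Sylow satF nP.
have sAA : <[a]> \subset A by rewrite cycle_subG.
have [c Ac] := Sylow_subJ sylA sAA pa.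
rewrite cycle_subG => /imsetP[_ /AutSP[x Nx ->] aE].
have Ax : conj_aut P x \in A by apply: AutS_AutF => //; apply/AutSP; exists x.
have vx : v (conj_aut P x) = 1.
  have [Fx xP] := AP _ Ax; have CN : 'N_S(P)%G \in C.
    by apply: (overC (fclass_refl F sPS)) => //; apply: subsetIl.
  have Nx' : x \in 'N_S('N_S(P)) by rewrite (subsetP _ x Nx) // subsetI subsetIl normG.
  rewrite -(smult_conj pS tC CN Nx' (subsetIl _ _)).
  apply: vE => //; first by apply: Fmor_conj; [apply: subsetIl | case/setIP: Nx].
  by move=> y Py; rewrite norm_conj_autE //; case/setIP: Nx.
rewrite aE conjgE !vM ?groupM ?groupV // vx mul1g -vM ?groupV // mulVg.
have v1 : v (1 : {perm gT}) * v (1 : {perm gT}) = v (1 : {perm gT}).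
  by rewrite -vM ?group1 // mulg1.
by apply: (mulgI (v (1 : {perm gT}))); rewrite mulg1.
Qed.

Variable hN : {group gT} -> gT -> gT.
Hypothesis hNE : forall Q, Q \in cl -> Fmor F 'N_S(Q) (hN Q) /\ img Q (hN Q) = P.

Let hi Q := Finv 'N_S(Q) (hN Q).
Let eta Q := t 'N_S(Q)%G (hN Q).
Let al Q f := hN (img Q f) \o (f \o hi Q).

(** [hN Q] carries [Q] to [P] and is defined on the larger subgroup ['N_S(Q)]; [al Q f]
    is [f] transported to an automorphism of [P].  Multiplicativity leaves no other
    choice for the value of [f], which is [hN Q], then [al Q f], then the inverse of
    [hN (img Q f)]. *)
Definition extend_mult Q f : Gamma :=
  if Q \in cl then eta Q * v (al Q f) * (eta (img Q f))^-1 else t Q f.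

Let sQN Q : Q \in cl -> Q \subset 'N_S(Q).
Proof. by move=> clQ; rewrite subsetI (fclass_sub clQ) normG. Qed.

Let pQN Q : Q \in cl -> Q \proper 'N_S(Q).
Proof.
move=> clQ; apply: (nilpotent_proper_norm (pgroup_nil pS)).
rewrite properEcard (fclass_sub clQ) (fclass_card clQ).
by apply: leq_trans (proper_card pNP) (subset_leq_card (subsetIl _ _)).
Qed.

Let NC Q : Q \in cl -> 'N_S(Q)%G \in C.
Proof. by move=> clQ; apply: overC (pQN clQ) (subsetIl _ _). Qed.

Let climg Q f : Q \in cl -> Fmor F Q f -> img Q f \in cl.
Proof. by move=> clQ Ff; apply: fclass_trans clQ (fclass_img Ff). Qed.

Let hiK Q x : Q \in cl -> x \in 'N_S(Q) -> hi Q (hN Q x) = x.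
Proof. by move=> clQ Nx; have [Fh _] := hNE clQ; apply: (FinvK Fh). Qed.

Let F_hi Q T : Q \in cl -> T \subset 'N_S(Q) -> Fmor F (img T (hN Q)) (hi Q).
Proof.
move=> clQ sTN; have [Fh _] := hNE clQ; apply: Fmor_res (Fmor_inv Fh).
by apply: (img_sub (Fmor_res sTN Fh)) => x Tx; rewrite (mem_img Fh) // (subsetP sTN).
Qed.

Let hi_mem Q T x : Q \in cl -> T \subset 'N_S(Q) -> x \in img T (hN Q) ->
  exists2 y, y \in T & x = hN Q y.
Proof.
move=> clQ sTN; have [Fh _] := hNE clQ.
by rewrite (imgE (Fmor_res sTN Fh)) => /imsetP.
Qed.

Lemma transport_mor Q T f : Q \in cl -> Q \subset T -> T \subset 'N_S(Q) -> Fmor F T f ->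
  Fmor F (img T (hN Q)) (al Q f) /\ img T f \subset 'N_S(img Q f).
Proof.
move=> clQ sQT sTN Ff; have [Fh hQ] := hNE clQ.
have nQT := subset_trans sTN (subsetIr _ _).
have sfN := img_norm sQT nQT Ff; split=> //.
have [Fh' _] := hNE (climg clQ (Fmor_res sQT Ff)).
have hiT x : x \in img T (hN Q) -> hi Q x \in T.
  by case/(hi_mem clQ sTN)=> y Ty ->; rewrite hiK // (subsetP sTN).
apply: (Fmor_comp _ Fh'); first exact: Fmor_comp (F_hi clQ sTN) Ff hiT.
by move=> x Tx /=; apply/(subsetP sfN)/(mem_img Ff)/hiT.
Qed.

Let alP Q f : Q \in cl -> Fmor F Q f -> Fmor F P (al Q f) /\ img P (al Q f) = P.
Proof.
move=> clQ Ff; have [Fh hQ] := hNE clQ; have [Fh' hQ'] := hNE (climg clQ Ff).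
have [] := transport_mor clQ (subxx _) (sQN clQ) Ff; rewrite hQ => Fal _; split=> //.
rewrite -{1}hQ -(img_comp _ (Fmor_res (sQN clQ) Fh)) -hQ' -(img_comp _ Ff).
by apply: img_eq => x Qx; rewrite /al /= hiK // (subsetP (sQN clQ)).
Qed.

(** Restricting [f] to the normalizer [T] of [Q] in [R] keeps it defined beyond [Q], and
    [T] lies in the domain of [hN Q]; transporting this restriction gives an extension of
    [al Q f] to a subgroup larger than [P], which computes [v (al Q f)]. *)
Lemma extend_mult_overgroup Q R f : Q \in cl -> Q \proper R -> R \in C -> Fmor F R f ->
  extend_mult Q f = t R f.
Proof.
move=> clQ pQR CR Ff; have [Fh hQ] := hNE clQ; rewrite /extend_mult clQ.
have sQR := proper_sub pQR; have FfQ := Fmor_res sQR Ff.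
have sRS := C_sub CR; have clQ' := climg clQ FfQ; have [Fh' hQ'] := hNE clQ'.
pose T := 'N_R(Q)%G; have sTR : T \subset R := subsetIl _ _.
have pQT : Q \proper T := nilpotent_proper_norm (pgroup_nil (pgroupS sRS pS)) pQR.
have sTN : T \subset 'N_S(Q) by rewrite setSI.
have CT : T \in C by apply: overC clQ pQT (subset_trans sTR sRS).
have sQT := proper_sub pQT; have FfT := Fmor_res sTR Ff.
have FhT := Fmor_res sTN Fh; have CT0 := img_C CT FhT.
have [Fal sfT] := transport_mor clQ sQT sTN FfT.
rewrite -(mult_res tC CT CR sTR Ff).
have nQT := subset_trans sTN (subsetIr _ _).
have [FalP alPP] := alP clQ FfQ.
have -> : v (al Q f) = t (img T (hN Q)) (al Q f).
  apply: vE => //; last first.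
    by rewrite -hQ; apply: img_norm sQT nQT FhT.
  rewrite properEcard (card_img FhT) -(fclass_card clQ) proper_card // andbT.
  rewrite -{1}hQ; apply: (img_sub (Fmor_res sQT FhT)) => x Qx.
  by rewrite (mem_img FhT) // (subsetP sQT).
have fT x : x \in T -> f x \in 'N_S(img Q f).
  by move=> Tx; apply/(subsetP sfT)/(mem_img FfT).
have CN' := NC clQ'; have CN := NC clQ.
have e1 := mult_comp tC CT CN' FfT Fh' fT.
have e2 := mult_comp tC CT CT0 FhT Fal (fun x => mem_img FhT (x := x)).
have e3 : t T (al Q f \o hN Q) = t T (hN (img Q f) \o f).
  apply/esym/(mult_eq tC) => //; first exact: Fmor_comp FfT Fh' fT.
  by move=> x Tx; rewrite /al /= hiK // (subsetP sTN).
rewrite /eta -(mult_res tC CT CN sTN Fh) -e2 e3 e1.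
by rewrite -mulgA mulgV mulg1.
Qed.

(** All three factors of the formula are values on subgroups containing a copy of [R],
    so they can be computed on these copies, where they telescope. *)
Lemma extend_mult_subgroup Q R f : Q \in cl -> R \subset Q -> R \in C -> Fmor F Q f ->
  extend_mult Q f = t R f.
Proof.
move=> clQ sRQ CR Ff; have [Fh hQ] := hNE clQ; rewrite /extend_mult clQ.
have clQ' := climg clQ Ff; have [Fh' hQ'] := hNE clQ'.
have sRN := subset_trans sRQ (sQN clQ); have CN := NC clQ; have CN' := NC clQ'.
have FfR := Fmor_res sRQ Ff; have FhR := Fmor_res sRN Fh; have CR0 := img_C CR FhR.
have [FalP alPP] := alP clQ Ff.
have [T [k [pT sT Fk kE ->]]] := ex_ext FalP alPP.
have [sTS _] := subsetIP sT; have CT : T \in C by apply: (overC (fclass_refl F sPS)).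
have sR0P : img R (hN Q) \subset P.
  suff: img R (hN Q) \subset img Q (hN Q) by rewrite hQ.
  apply: (img_sub FhR) => x Rx.
  by rewrite (mem_img (Fmor_res (sQN clQ) Fh)) // (subsetP sRQ).
have sR0T := subset_trans sR0P (proper_sub pT).
have Fk0 := Fmor_res sR0T Fk.
rewrite -(mult_res tC CR0 CT sR0T Fk) /eta -(mult_res tC CR CN sRN Fh).
rewrite -(mult_comp tC CR CR0 FhR Fk0 (fun x => mem_img FhR (x := x))).
have fR x : x \in R -> f x \in 'N_S(img Q f).
  by move=> Rx; apply/(subsetP (sQN clQ'))/(mem_img Ff)/(subsetP sRQ).
have -> : t R (k \o hN Q) = t R (hN (img Q f) \o f).
  apply/esym/(mult_eq tC) => //; first exact: Fmor_comp FfR Fh' fR.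
  move=> x Rx; rewrite /= kE /al /= ?hiK // ?(subsetP sRN) //.
  exact: (subsetP sR0P) (mem_img FhR Rx).
by rewrite (mult_comp tC CR CN' FfR Fh' fR) -mulgA mulgV mulg1.
Qed.

Lemma extend_mult_class Q f h : Q \in cl -> Fmor F Q f -> Fmor F (img Q f) h ->
  extend_mult Q (h \o f) = extend_mult Q f * extend_mult (img Q f) h.
Proof.
move=> clQ Ff Fh; have clQ' := climg clQ Ff; rewrite /extend_mult clQ clQ'.
have [Fa aP] := alP clQ Ff; have [Fb bP] := alP clQ' Fh.
have Fhf := Fmor_comp Ff Fh (fun x => mem_img Ff (x := x)).
have [Fc cP'] := alP clQ Fhf.
have -> : v (al Q (h \o f)) = v (al Q f) * v (al (img Q f) h).
  rewrite -v_comp //; apply: v_eq => // x; have [Fg hQ] := hNE clQ.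
  rewrite -{1}hQ => /(hi_mem clQ (sQN clQ))[y Qy ->].
  have Ny := subsetP (sQN clQ) y Qy; rewrite /al (img_comp _ Ff) /= !hiK //.
  by apply/(subsetP (sQN clQ'))/(mem_img Ff).
by rewrite (img_comp _ Ff) !mulgA mulgVK.
Qed.

(** [C] and the class of [P] are disjoint.  In the composition rule a source in the
    class and a target in [C] is the situation of [extend_mult_overgroup], the opposite
    one that of [extend_mult_subgroup]; if both lie in the class, [f] is onto [R]. *)
Lemma smult_extend_mult : smult F p (C :|: cl) extend_mult.
Proof.
have notC Q : Q \in cl -> Q \notin C.
  by move=> clQ; apply: contra notCP => CQ; apply: conjC CQ (fclass_sym clQ).
have CE Q : Q \in C -> Q \in cl = false.
  by move=> CQ; apply/negP=> /notC; rewrite CQ.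
split; first split=> [Q f h|Q R f h].
- case/setUP=> [CQ|clQ] Ff fh; rewrite /extend_mult.
    by rewrite (CE Q CQ); apply: (mult_eq tC).
  rewrite clQ (img_eq fh); congr (_ * _ * _).
  have [Fa aP] := alP clQ Ff; apply: v_eq => // x.
  have [Fg hQ] := hNE clQ; rewrite -{1}hQ => /(hi_mem clQ (sQN clQ))[y Qy ->].
  by rewrite /al (img_eq fh) /= hiK ?fh // (subsetP (sQN clQ)).
- case/setUP=> [CQ|clQ] /setUP[CR|clR] Ff Fh fQR.
  + by rewrite /extend_mult (CE Q CQ) (CE R CR); apply: (mult_comp tC).
  + have CfQ := img_C CQ Ff; have sfR := img_sub Ff fQR.
    rewrite (extend_mult_subgroup clR sfR CfQ Fh) /extend_mult (CE Q CQ).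
    apply: (mult_comp tC) => //; first exact: Fmor_res Fh.
    by move=> x; apply: (mem_img Ff).
  + have clfQ := climg clQ Ff; have sfR := img_sub Ff fQR.
    rewrite extend_mult_class //; last exact: Fmor_res Fh.
    congr (_ * _); rewrite (@extend_mult_overgroup _ R) //; last first.
      rewrite properEneq sfR andbT; apply: contraTneq CR => /val_inj <-.
      exact: notC.
    by rewrite /extend_mult (CE R CR).
  have sfR := img_sub Ff fQR; suff <- : img Q f = R.
    rewrite extend_mult_class //; exact: Fmor_res Fh.
  apply/val_inj/eqP; rewrite [_ == _]eqEcard sfR /= [#|val (img _ _)|](card_img Ff).
  by rewrite (fclass_card clQ) (fclass_card clR).
move=> Q a /setUP[CQ|clQ] Aa pa; rewrite /extend_mult.
  by rewrite (CE Q CQ); apply: (smult_p_elt tC).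
have sQS := fclass_sub clQ; have Fa := AutF_Fmor sQS Aa.
rewrite clQ (AutF_img sQS Aa); have [Fb bP] := alP clQ Fa.
have [Fg hQ] := hNE clQ.
have [|b Ab bE] := Fmor_AutF Fb.
  by exact: img_to Fb bP.
have -> : v (al Q a) = v b by apply: v_eq => // x Px; rewrite bE.
suff pb : p.-elt b by rewrite v_p_elt // mulg1 mulgV.
apply: (p_elt_AutF Ab pa) => x; rewrite -{1}hQ => /(hi_mem clQ (sQN clQ))[y Qy ->].
(* Powers of [b] are transported from powers of [a], so the order of [b] divides
   that of [a]. *)
suff bX n : (b ^+ n) (hN Q y) = hN Q ((a ^+ n) y) by rewrite bX expg_order perm1.
have aX i : (a ^+ i) y \in Q.
  by elim: i => [|i IHi]; rewrite ?perm1 // expgSr permM (AutF_mem Aa).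
have Fg' := Fmor_res (sQN clQ) Fg.
elim: n => [|n IHn]; first by rewrite !perm1.
rewrite !expgSr !permM IHn bE; last by rewrite -hQ (mem_img Fg').
by rewrite /al (AutF_img sQS Aa) /= hiK // (subsetP (sQN clQ)).
Qed.

End ExtendStep.

Section ExtendToCentric.

Variables (gT : finGroupType) (S : {group gT}) (F : fusion_system S) (p : nat).
Hypotheses (pS : p.-group S) (satF : fsaturated F p).
Variables (Gamma : groupType).
Implicit Types (C : {set {group gT}}) (P Q : {group gT}).
Implicit Types (t : {group gT} -> (gT -> gT) -> Gamma).

Lemma extend_class C t P : C \subset fcentric F -> conj_closed F C -> smult F p C t ->
    P \in fcentric F -> P \notin C -> fully_normalized F P -> ~~ fradical F p P ->
    (forall T : {group gT}, T \in fcentric F -> #|P| < #|T| -> T \in C) ->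
  exists t', smult F p (C :|: fclass F P) t' /\ {in C, forall Q f, t' Q f = t Q f}.
Proof.
move=> sCc conjC tC cP notCP nP nradP bigC.
have [v vE] := ex_aut_val pS satF tC nP cP nradP bigC.
have : forall Q : {group gT}, exists h,
    Q \in fclass F P -> Fmor F 'N_S(Q) h /\ img Q h = P.
  move=> Q; have [clQ|nclQ] := boolP (Q \in fclass F P); last by exists id.
  by have [h Fh hP] := transporter pS satF nP clQ; exists h.
case/choice=> hN hNE.
exists (extend_mult F t P v hN); split.
  exact: (smult_extend_mult pS satF sCc conjC tC nP cP nradP notCP bigC vE hNE).
move=> Q CQ f; rewrite /extend_mult; case: ifP => // clQ.
by case/negP: notCP; apply: conjC CQ (fclass_sym clQ).
Qed.

(** Induction on the number of centric subgroups outside [C].  Choosing one of maximal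
    order ensures that all larger centric subgroups are in [C]. *)
Lemma extend_to_centric C t : C \subset fcentric F -> conj_closed F C ->
    (forall P, P \in fcentric F -> fradical F p P -> P \in C) -> smult F p C t ->
  exists t', smult F p (fcentric F) t' /\ {in C, forall Q f, t' Q f = t Q f}.
Proof.
have [n] := ubnP #|fcentric F :\: C|; elim: n C t => // n IHn C t leCn sCc conjC radC tC.
have [sFC|] := boolP (fcentric F \subset C).
  by exists t; split=> //; have -> : fcentric F = C by apply/eqP; rewrite eqEsubset sFC.
case/subsetPn=> P1 cP1 nP1.
have P1D : P1 \in fcentric F :\: C by rewrite inE nP1.
case: (arg_maxnP (fun Q : {group gT} => #|Q|) P1D) => P2 /setDP[cP2 nP2] maxP2.
have [P clP nP] := ex_fully_normalized F (fcentric_sub cP2).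
have cP := fcentric_conj cP2 clP.
have notCP : P \notin C by apply: contra nP2 => CP; apply: conjC CP (fclass_sym clP).
have [|T cT|t1 [t1C t1E]] := extend_class sCc conjC tC cP notCP nP.
- by apply: contra notCP; apply: radC.
- rewrite (fclass_card clP) ltnNge; apply: contraR => nCT.
  by apply: maxP2; apply/setDP.
have [|||P3 cP3 rP3||t2 [t2C t2E]] := IHn (C :|: fclass F P) t1.
- rewrite -ltnS; apply: leq_trans leCn; apply: proper_card.
  rewrite properE setDS ?subsetUl //=; apply/subsetPn; exists P; first exact/setDP.
  by rewrite in_setD in_setU (fclass_refl F (fcentric_sub cP)) orbT.
- by rewrite subUset sCc; apply/subsetP=> Q clQ; apply: fcentric_conj cP clQ.
- move=> Q R /setUP[CQ|clQ] QR; apply/setUP; [left|right]; first exact: conjC QR.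
  exact: fclass_trans QR.
- by apply/setUP; left; apply: radC.
- exact: t1C.
exists t2; split=> // Q CQ f; rewrite t2E ?t1E //.
by apply/setUP; left.
Qed.

End ExtendToCentric.

(** * Uniqueness, and the value on [Aut0] *)

Section Uniqueness.

Variables (gT : finGroupType) (S : {group gT}) (F : fusion_system S) (p : nat).
Hypotheses (pS : p.-group S) (satF : fsaturated F p).
Variable Gamma : groupType.
Variables t1 t2 : {group gT} -> (gT -> gT) -> Gamma.
Hypotheses (t1F : smult F p (fcentric F) t1) (t2F : smult F p (fcentric F) t2).
Hypothesis t12S : {in AutF F S, forall a : {perm gT}, t1 S a = t2 S a}.
Implicit Types (P Q : {group gT}) (f : gT -> gT).

(** The automorphisms killed by both maps form a normal subgroup [K] containing the Sylow
    subgroup [AutS S P]; by the Frattini argument it remains to treat automorphisms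
    normalizing [AutS S P], and these extend to ['N_S(P)]. *)
Lemma fully_normalized_agree P : P \in fcentric F -> fully_normalized F P ->
  (forall f, Fmor F 'N_S(P) f -> t1 'N_S(P)%G f = t2 'N_S(P)%G f) ->
  {in AutF F P, forall a : {perm gT}, t1 P a = t2 P a}.
Proof.
move=> cP nP eqN; have sPS := fcentric_sub cP; pose A := Group (AutF_group_set F sPS).
have sPN : P \subset 'N_S(P) by rewrite subsetI sPS normG.
have cN : 'N_S(P)%G \in fcentric F := fcentric_over cP sPN (subsetIl _ _).
have u1M := AutF_morph sPS cP t1F; have u2M := AutF_morph sPS cP t2F.
have sylA : p.-Sylow(A) (AutS S P) := fully_normalized_Sylow satF nP.
(* The kernel of the homomorphism to the product group. *)
have [|K nKA KE] := @ker_normal _ A _ (fun a : {perm gT} => (t1 P a, t2 P a)).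
  by move=> a b Aa Ab /=; rewrite [t1 _ _]u1M // [t2 _ _]u2M.
have sSK : AutS S P \subset K.
  apply/subsetP=> a Sa; have Aa : a \in A := AutS_AutF F sPS Sa.
  have pa := AutS_p_elt pS Sa; rewrite KE Aa; apply/eqP.
  by rewrite (smult_p_elt t1F cP Aa pa) (smult_p_elt t2F cP Aa pa).
have sylK : p.-Sylow(K) (AutS S P) by apply: (pHall_subl sSK (normal_sub nKA)).
have Frat := Frattini_arg nKA sylK.
move=> a Aa; have : a \in A by [].
rewrite -Frat => /mulsgP[k n Kk /setIP[An Nn] ->{a Aa}].
have [Ak /eqP[k1 k2]] : k \in A /\ (t1 P k, t2 P k) == 1 by apply/andP; rewrite -KE.
rewrite [t1 _ _]u1M // [t2 _ _]u2M // k1 k2 !mul1g.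
have Fn := AutF_Fmor sPS An.
have cenP := fully_normalized_centralized satF nP.
have [x Nx|h Fh hE] := extend_over satF Fn (AutF_img sPS An) cenP sPN (subxx _).
  exists (conj_aut P x ^ n); first by rewrite memJ_norm //; apply/AutSP; exists x.
  move=> y Py; rewrite conjgE !permM permK norm_conj_autE //.
  by case/setIP: Nx.
have ext (t : {group gT} -> (gT -> gT) -> Gamma) : smult F p (fcentric F) t -> t P n = t 'N_S(P)%G h.
  move=> tF; rewrite -(mult_res tF cP cN sPN Fh); apply: (mult_eq tF) => //.
  by move=> x Px; rewrite hE.
by rewrite (ext t1) // (ext t2) // eqN.
Qed.

(** A morphism [f] from [P] factors through a fully normalized conjugate [P0] as
    [transporter] of [P], then an automorphism [a] of [P0], then the inverse of the
    [transporter] of the image; the outer factors are restricted from normalizers,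
    where the induction hypothesis applies. *)
Lemma smult_unique P f : P \in fcentric F -> Fmor F P f -> t1 P f = t2 P f.
Proof.
have [n] := ubnP (#|S| - #|P|); elim: n P f => // n IHn P f ltn cP Ff.
have sPS := fcentric_sub cP; have clP := fclass_refl F sPS.
have [PS|pPS] := eqVproper sPS.
  have ePS : P = S by apply: val_inj.
  rewrite ePS in cP Ff *; have [|a Aa aE] := Fmor_AutF Ff.
    by move=> x Sx; apply/(subsetP (imgS Ff))/(mem_img Ff).
  have fa : {in S, f =1 a} by move=> x Sx; rewrite aE.
  by rewrite (mult_eq t1F cP Ff fa) (mult_eq t2F cP Ff fa) t12S.
have eqN Q h : Q \in fclass F P -> Fmor F 'N_S(Q) h -> t1 'N_S(Q)%G h = t2 'N_S(Q)%G h.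
  move=> PQ Fh; have sQS := fclass_sub PQ; apply: IHn => //.
    have: Q \proper S by rewrite properEcard sQS (fclass_card PQ) proper_card.
    move/(nilpotent_proper_norm (pgroup_nil pS))/proper_card; rewrite (fclass_card PQ).
    move=> ltPN; apply: leq_trans (ltnSE ltn); apply: ltn_sub2l => //.
    exact: proper_card.
  apply: fcentric_over (fcentric_conj cP PQ) _ (subsetIl _ _).
  by rewrite subsetI sQS normG.
have [P0 PP0 nP0] := ex_fully_normalized F sPS.
have cP0 := fcentric_conj cP PP0.
have PQ := fclass_img Ff; have P0P := fclass_sym PP0; have P0Q := fclass_trans P0P PQ.
have [h1 Fh1 h1P] := transporter pS satF nP0 P0P.
have [h2 Fh2 h2P] := transporter pS satF nP0 P0Q.
have sQN Q : Q \in fclass F P -> Q \subset 'N_S(Q).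
  by move=> PQ'; rewrite subsetI (fclass_sub PQ') normG.
have Fh1P := Fmor_res (sQN _ clP) Fh1; have Fh2Q := Fmor_res (sQN _ PQ) Fh2.
have cQ := fcentric_conj cP PQ.
have fQ x : x \in P -> f x \in img P f by apply: (mem_img Ff).
have Fg := Fmor_comp Ff Fh2Q fQ.
have Finv1 : Fmor F P0 (Finv P h1) by rewrite -h1P; apply: (Fmor_inv Fh1P).
have invP x : x \in P0 -> Finv P h1 x \in P by rewrite -h1P; apply: (mem_Finv Fh1P).
have Falpha := Fmor_comp Finv1 Fg invP.
have [|a Aa aE] := Fmor_AutF Falpha.
  by move=> x P0x /=; apply: (img_to Fh2Q h2P); apply/fQ/invP.
have Fa := AutF_Fmor (fcentric_sub cP0) Aa.
have h1P0 := img_to Fh1P h1P.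
have val (t : {group gT} -> (gT -> gT) -> Gamma) : smult F p (fcentric F) t ->
    t P f * t 'N_S(img P f)%G h2 = t 'N_S(P)%G h1 * t P0 a.
  move=> tF; have cN Q : Q \in fclass F P -> 'N_S(Q)%G \in fcentric F.
    move=> PQ'; apply: fcentric_over (fcentric_conj cP PQ') (sQN Q PQ') (subsetIl _ _).
  rewrite -(mult_res tF cP (cN P clP) (sQN P clP) Fh1).
  rewrite -(mult_res tF cQ (cN _ PQ) (sQN _ PQ) Fh2).
  rewrite -(mult_comp tF cP cQ Ff Fh2Q fQ) -(mult_comp tF cP cP0 Fh1P Fa h1P0).
  by apply: (mult_eq tF) => // x Px; rewrite /= aE ?h1P0 //= (FinvK Fh1P).
apply: (mulIg (t1 'N_S(img P f)%G h2)).
rewrite (val t1) // [in RHS]eqN // (val t2) // (eqN P) //.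
congr (_ * _); apply: fully_normalized_agree => // h; exact: eqN.
Qed.

End Uniqueness.

Section OpstarKernel.

Variables (gT : finGroupType) (S : {group gT}) (F : fusion_system S) (p : nat).
Hypotheses (p_pr : prime p) (pS : p.-group S).
Variable Gamma : groupType.
Variable t : {group gT} -> (gT -> gT) -> Gamma.
Hypothesis tF : smult F p (fcentric F) t.
Implicit Types (P Q R : {group gT}) (f g : {ffun gT -> gT}).

Lemma S_fcentric : S \in fcentric F.
Proof.
apply/fcentricP; split=> // Q SQ; suff -> : Q = S by apply: subsetIl.
by apply/val_inj/eqP; rewrite [_ == _]eqEcard (fclass_sub SQ) (fclass_card SQ) /=.
Qed.

(** [t] has a meaning on centric subgroups only, so nothing is required elsewhere.  This
    is consistent with composition because the conjugates and the overgroups of centric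
    subgroups are centric. *)
Definition ker_hom P Q : {set {ffun gT -> gT}} :=
  [set f in F P Q | (P \in fcentric F) ==> (t P f == 1)].

Lemma ker_hom_sub P Q f : f \in ker_hom P Q ->
  [/\ P \subset S, Q \subset S & injhom P Q f].
Proof. by case/setIdP=> /fhom_sub. Qed.

Lemma ker_hom_comp P Q R f g :
  f \in ker_hom P Q -> g \in ker_hom Q R -> fcomp P f g \in ker_hom P R.
Proof.
case/setIdP=> Ff /implyP tf /setIdP[Fg /implyP tg].
apply/setIdP; split; first exact: fhom_comp Ff Fg.
apply/implyP=> cP; have Ff' := fhom_Fmor Ff; have Fg' := fhom_Fmor Fg.
have [_ _ [_ _ fPQ _]] := fhom_sub Ff; have [sPS sQS _] := fhom_sub Ff.
have fQ x : x \in P -> f x \in Q by move=> Px; rewrite (subsetP fPQ) ?imset_f.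
have cQ : Q \in fcentric F.
  apply: fcentric_over (fcentric_conj cP (fclass_img Ff')) _ sQS.
  exact: img_sub Ff' fQ.
have Fc := Fmor_comp Ff' Fg' fQ.
have e : t P (g \o f) = t P (fcomp P f g).
  by apply: (mult_eq tF) => // x Px; rewrite frestrE.
by rewrite -e (mult_comp tF cP cQ Ff' Fg' fQ) (eqP (tf cP)) (eqP (tg cQ)) mulg1.
Qed.

Lemma ker_hom_conj P Q x : P \subset S -> Q \subset S -> x \in S ->
  P :^ x \subset Q -> frestr P (conjg^~ x) \in ker_hom P Q.
Proof.
move=> sPS sQS Sx sPQ; apply/setIdP; split; first exact: fhom_conj.
apply/implyP=> cP; have Fc := Fmor_conj F sPS Sx.
rewrite -(mult_eq tF cP Fc); last by move=> y Py; rewrite frestrE.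
have FcS := Fmor_conj F (subxx S) Sx.
rewrite (mult_res tF cP S_fcentric sPS FcS).
rewrite (smult_conj pS tF S_fcentric) //.
by rewrite inE Sx (subsetP (normG S)).
Qed.

Lemma ker_hom_inv P Q R f : f \in ker_hom P Q -> f @: P = R ->
  finvon P f \in ker_hom R P.
Proof.
case/setIdP=> Ff /implyP tf fPR; apply/setIdP; split; first exact: fhom_inv Ff fPR.
have Ff' := fhom_Fmor Ff; have fP : img P f = R by apply: val_inj; rewrite [LHS](imgE Ff').
have sPS := Fmor_sub Ff'; have Fi := fhom_Fmor (fhom_inv Ff fPR).
have [_ _ [_ injf _ _]] := fhom_sub Ff; have fK := finvonK injf.
apply/implyP=> cR; have cP : P \in fcentric F.
  by apply: fcentric_conj cR (fclass_sym _); rewrite -fP fclass_img.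
have := mult_comp tF cP cR Ff' Fi (img_to Ff' fP); rewrite (eqP (tf cP)) mul1g => <-.
rewrite -(mult_id tF cP sPS); apply/eqP/esym/(mult_eq tF) => //.
  exact: Fmor_id.
by move=> x Px; rewrite /= fK.
Qed.

Definition ker_fusion : fusion_system S :=
  FusionSystem ker_hom_sub ker_hom_comp ker_hom_conj ker_hom_inv.

Lemma ker_fusion_Op' : contains_Op' F p ker_fusion.
Proof.
move=> P sPS a Oa; pose A := Group (AutF_group_set F sPS).
apply/setIdP; split; first exact: contains_Op'_self Oa.
apply/implyP=> cP; have Aa : a \in A.
  by apply: (subsetP (Op'res_sub p_pr (normal_refl A) _)) Oa.
rewrite -(mult_eq tF cP (AutF_Fmor sPS Aa)); last by move=> x Px; rewrite frestrE.
apply/eqP; apply: (@Op'res_morph _ p A _ (fun a : {perm gT} => t P a)) Oa => //.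
  exact: (AutF_morph sPS cP tF).
by move=> b Ab pb; apply: (smult_p_elt tF).
Qed.

Lemma Opstar_val P f : P \in fcentric F -> f \in Opstar F p P S -> t P f = 1.
Proof.
move=> cP /Opstar_homP/(_ ker_fusion ker_fusion_Op')/setIdP[_].
by rewrite cP => /eqP.
Qed.

Lemma Aut0_val : {in Aut0 F p, forall a : {perm gT}, t S a = 1}.
Proof.
have cS := S_fcentric; pose A := Group (AutF_group_set F (subxx S)).
have [K nKA KE] := @ker_normal _ A _ (fun a : {perm gT} => t S a)
  (AutF_morph (subxx S) cS tF).
suff sK : Aut0 F p \subset K by move=> a /(subsetP sK); rewrite KE => /andP[_ /eqP].
rewrite gen_subG; apply/subsetP=> a /setIdP[Aa /existsP[P /andP[cP Oa]]].
rewrite KE Aa /=; have Fa := AutF_Fmor (subxx S) Aa; have sPS := fcentric_sub cP.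
rewrite -(mult_res tF cP cS sPS Fa) (mult_eq tF cP (Fmor_res sPS Fa) (g := frestr P a)).
  by rewrite Opstar_val.
by move=> x Px; rewrite frestrE.
Qed.

End OpstarKernel.

Section ConjugateOpstar.

Variables (gT : finGroupType) (S : {group gT}) (F : fusion_system S) (p : nat).
Variable b : {perm gT}.
Hypothesis Ab : b \in AutF F S.
Implicit Types (P Q R : {group gT}) (f g : {ffun gT -> gT}) (a : {perm gT}).

(** The conjugate of [f] by [b], a morphism between the images under [b] of the source
    and of the target of [f]. *)
Definition ffunJ f : {ffun gT -> gT} := [ffun x => b (f ((b^-1)%g x))].

Let Fb : Fmor F S b := AutF_Fmor (subxx S) Ab.

Lemma AutF_S_V : (b^-1)%g \in AutF F S.
Proof. by rewrite -[AutF F S]/(gval (Group (AutF_group_set F (subxx S)))) groupV. Qed.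

Lemma mem_imgb P x : P \subset S -> (x \in img P b) = ((b^-1)%g x \in P).
Proof.
move=> sPS; rewrite (imgE (Fmor_res sPS Fb)) -{1}[x](permKV b) mem_imset //.
exact: perm_inj.
Qed.

Lemma imgb_sub P : P \subset S -> img P b \subset S.
Proof. by move=> sPS; apply: imgS (Fmor_res sPS Fb). Qed.

Lemma ffunJ_frestr P (f : gT -> gT) : P \subset S ->
  ffunJ (frestr P f) = frestr (img P b) (b \o (f \o (b^-1)%g)).
Proof.
move=> sPS; apply/ffunP=> x; rewrite !ffunE mem_imgb //.
by case: ifP => //; rewrite permKV.
Qed.

Lemma AutF_conj P a : P \subset S -> a \in AutF F P -> a ^ b \in AutF F (img P b).
Proof.
move=> sPS Aa; have sbS := imgb_sub sPS.
have FbP := Fmor_res sPS Fb; have Fbi := Fmor_res sbS (AutF_Fmor (subxx S) AutF_S_V).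
have biP x : x \in img P b -> (b^-1)%g x \in P by rewrite mem_imgb.
have aP x : x \in P -> a x \in P by apply: (AutF_mem Aa).
have Fc := Fmor_comp (Fmor_comp Fbi (AutF_Fmor sPS Aa) biP) FbP (fun x Px => aP _ (biP x Px)).
have [|c Ac cE] := Fmor_AutF Fc.
  by move=> x Px; apply/(mem_img FbP)/aP/biP.
suff -> : a ^ b = c by [].
apply/permP=> x; rewrite conjgE !permM.
have [Px|Px] := boolP (x \in img P b); first by rewrite cE.
have [AutP _] := setIdP Aa; have [Autc _] := setIdP Ac.
by rewrite (out_Aut Autc) // (out_Aut AutP) ?permKV // -mem_imgb.
Qed.

End ConjugateOpstar.

Section Aut0Normal.

Variables (gT : finGroupType) (S : {group gT}) (F : fusion_system S) (p : nat).
Implicit Types (P Q R : {group gT}) (f g : {ffun gT -> gT}) (a b : {perm gT}).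

Lemma img_permV P b : P \subset S -> b \in AutF F S -> img (img P b) (b^-1)%g = P.
Proof.
move=> sPS Ab; have Fb := Fmor_res sPS (AutF_Fmor (subxx S) Ab).
rewrite -(img_comp _ Fb) -[RHS]img_id; apply: img_eq => x _ /=.
by rewrite permK.
Qed.

Lemma AutF_img_conj P b : P \subset S -> b \in AutF F S ->
  AutF F (img P b) = AutF F P :^ b.
Proof.
move=> sPS Ab; apply/setP=> a; rewrite mem_conjg; apply/idP/idP=> Aa.
  have := AutF_conj (AutF_S_V Ab) (imgb_sub Ab sPS) Aa.
  by rewrite img_permV.
by rewrite -[a](conjgKV b); apply: AutF_conj.
Qed.

Lemma Op'res_img P b a : P \subset S -> b \in AutF F S ->
  a \in Op'res p (AutF F P) -> a ^ b \in Op'res p (AutF F (img P b)).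
Proof.
move=> sPS Ab /bigcapP Oa; rewrite AutF_img_conj //.
apply/bigcapP=> H /andP[nH iH]; rewrite -mem_conjgV; apply: (Oa (H :^ b^-1)%G).
pose A := Group (AutF_group_set F sPS).
have HJ : (H :^ b^-1) :^ b = H by rewrite -conjsgM mulVg conjsg1.
by rewrite -(normalJ _ _ b) -(indexJg A (H :^ b^-1)%G b) /= HJ nH.
Qed.

Variable b : {perm gT}.
Hypothesis Ab : b \in AutF F S.

(** The pullback of [Opstar F p] along conjugation by [b].  It is a fusion system that
    again contains all the [Op'res p (AutF F P)], so by minimality it contains
    [Opstar F p]: this is the invariance on which the normality of [Aut0] rests. *)
Definition conj_hom P Q : {set {ffun gT -> gT}} :=
  [set f in F P Q | ffunJ b f \in Opstar F p (img P b) (img Q b)].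

Lemma conj_hom_sub P Q f : f \in conj_hom P Q ->
  [/\ P \subset S, Q \subset S & injhom P Q f].
Proof. by case/setIdP=> /fhom_sub. Qed.

Lemma conj_hom_comp P Q R f g :
  f \in conj_hom P Q -> g \in conj_hom Q R -> fcomp P f g \in conj_hom P R.
Proof.
case/setIdP=> Ff Of /setIdP[Fg Og]; apply/setIdP; split; first exact: fhom_comp Ff Fg.
have [sPS _ _] := fhom_sub Ff; have := fhom_comp Of Og.
rewrite {2}/fcomp (ffunJ_frestr Ab) //.
suff -> : fcomp (img P b) (ffunJ b f) (ffunJ b g)
  = frestr (img P b) (b \o ((g \o f) \o (b^-1)%g)) by [].
by apply: frestr_eq => x _; rewrite /= !ffunE permK.
Qed.

Lemma conj_hom_conj P Q x : P \subset S -> Q \subset S -> x \in S ->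
  P :^ x \subset Q -> frestr P (conjg^~ x) \in conj_hom P Q.
Proof.
move=> sPS sQS Sx sPQ; apply/setIdP; split; first exact: fhom_conj.
have Fb := AutF_Fmor (subxx S) Ab; have Sbx : b x \in S by apply: (AutF_mem Ab).
have bJ y : y \in P -> b (y ^ x) = b y ^ b x.
  by move=> Py; rewrite (FmorJ Fb) // (subsetP sPS).
rewrite (ffunJ_frestr Ab) // (@frestr_eq _ _ _ (conjg^~ (b x))); last first.
  by move=> y; rewrite (mem_imgb Ab) // => Py /=; rewrite bJ // permKV.
apply: fhom_conj; rewrite ?(imgb_sub Ab) //.
apply/subsetP=> _ /imsetP[y Py ->]; move: Py; rewrite !(mem_imgb Ab) // => Py.
rewrite -{1}[y](permKV b) -bJ // permK (subsetP sPQ) //.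
by rewrite memJ_conjg.
Qed.

Lemma conj_hom_inv P Q R f : f \in conj_hom P Q -> f @: P = R ->
  finvon P f \in conj_hom R P.
Proof.
case/setIdP=> Ff Of fPR; apply/setIdP; split; first exact: fhom_inv Ff fPR.
have [sPS sQS _] := fhom_sub Ff; have [sRS _ _] := fhom_sub (fhom_inv Ff fPR).
have fbR : ffunJ b f @: img P b = img R b.
  apply/setP=> y; rewrite (mem_imgb Ab) // -fPR; apply/imsetP/idP => [[x]|/imsetP[x Px bx]].
    rewrite (mem_imgb Ab) // => Px ->; apply/imsetP; exists ((b^-1)%g x) => //.
    by rewrite ffunE permK.
  exists (b x); first by rewrite (mem_imgb Ab) // permK.
  by rewrite ffunE permK -bx permKV.
have := fhom_inv Of fbR; suff -> : finvon (img P b) (ffunJ b f) = ffunJ b (finvon P f) by [].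
apply/ffunP=> y; rewrite !ffunE.
have [_ _ [_ injf _ _]] := fhom_sub Ff.
case: pickP => [x /andP[bPx /eqP fx]|nox] /=; case: pickP => [z /andP[Pz /eqP fz]|noz] /=.
- move: bPx fx; rewrite (mem_imgb Ab) // ffunE => Px fx.
  suff <- : (b^-1)%g x = z by rewrite permKV.
  by apply: injf => //; rewrite fz -fx permK.
- move: bPx fx; rewrite (mem_imgb Ab) // ffunE => Px fx.
  by have := noz ((b^-1)%g x); rewrite Px -fx permK eqxx.
- by have := nox (b z); rewrite (mem_imgb Ab) // permK Pz ffunE permK fz permKV eqxx.
by rewrite permKV.
Qed.

Definition conj_fusion : fusion_system S :=
  FusionSystem conj_hom_sub conj_hom_comp conj_hom_conj conj_hom_inv.

Lemma conj_fusion_Op' : contains_Op' F p conj_fusion.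
Proof.
move=> P sPS a Oa; apply/setIdP; split; first exact: contains_Op'_self Oa.
rewrite (ffunJ_frestr Ab) //.
have := Opstar_contains (imgb_sub Ab sPS) (Op'res_img sPS Ab Oa).
congr (_ \in Opstar F p _ _); apply: frestr_eq => x _.
by rewrite conjgE !permM.
Qed.

Lemma Opstar_ffunJ P Q f : f \in Opstar F p P Q ->
  ffunJ b f \in Opstar F p (img P b) (img Q b).
Proof. by move/Opstar_homP/(_ conj_fusion conj_fusion_Op')/setIdP=> []. Qed.

Lemma Aut0_conj a : a \in Aut0 F p -> a ^ b \in Aut0 F p.
Proof.
rewrite -mem_conjgV /Aut0 -genJ; apply: subsetP; apply: genS.
apply/subsetP=> c /setIdP[Ac /existsP[P /andP[cP Oc]]].
have sPS := fcentric_sub cP; rewrite mem_conjgV inE.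
apply/andP; split.
  by have := AutF_conj Ab (subxx S) Ac; rewrite (AutF_img (subxx S) Ab).
apply/existsP; exists (img P b); apply/andP; split.
  apply: fcentric_conj cP (fclass_img _).
  exact: Fmor_res sPS (AutF_Fmor (subxx S) Ab).
have := Opstar_ffunJ Oc; rewrite (ffunJ_frestr Ab) // (AutF_img (subxx S) Ab).
congr (_ \in Opstar F p _ _); apply: frestr_eq => x _.
by rewrite conjgE !permM.
Qed.

End Aut0Normal.

(** * The quotient [Gamma_p'] and the universal property *)

Section Quotient.

Variables (gT : finGroupType) (S : {group gT}) (F : fusion_system S) (p : nat).
Hypotheses (pS : p.-group S) (satF : fsaturated F p).
Implicit Types (a b : {perm gT}).

Let A := Group (AutF_group_set F (subxx S)).

Lemma S_fully_normalized : fully_normalized F S.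
Proof.
by split=> // Q _; rewrite (setIidPl (normG S)) subset_leq_card ?subsetIl.
Qed.

Lemma AutS_S : AutS S S = Inn S.
Proof. by rewrite /AutS (setIidPl (normG S)). Qed.

(** [OutF F S] is a [p']-group, since [Inn S = AutS S S] is a Sylow subgroup. *)
Lemma S_fradical : fradical F p S.
Proof.
have sylA : p.-Sylow(A) (AutS S S) := fully_normalized_Sylow satF S_fully_normalized.
have p'Q : p^'.-group (A / Inn S).
  rewrite /pgroup card_quotient ?(normal_norm (Inn_normal F (subxx S))) //.
  by case/and3P: sylA; rewrite AutS_S.
rewrite /fradical /OutF -[AutF F S]/(gval A).
have p'O : p^'.-group 'O_p(A / Inn S) := pgroupS (pcore_sub _ _) p'Q.
by rewrite trivg_card1 (pnat_1 (pcore_pgroup p _) p'O).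
Qed.

Lemma Aut0_normal : [group of Aut0 F p] <| A.
Proof.
apply/andP; split.
  by rewrite gen_subG; apply/subsetP=> a /setIdP[].
apply/subsetP=> b Ab; rewrite inE; apply/subsetP=> _ /imsetP[a Oa ->].
exact: (Aut0_conj (F:=F) Ab Oa).
Qed.

Lemma Inn_Aut0 : Inn S \subset Aut0 F p.
Proof.
apply/subsetP=> a; rewrite -AutS_S => Sa; apply: mem_gen; apply/setIdP; split.
  exact: AutS_AutF.
apply/existsP; exists S; rewrite S_fcentric /=; case/AutSP: Sa => x Nx ->.
have [Sx nSx] := setIP Nx; rewrite (@frestr_eq _ _ _ (conjg^~ x)).
  exact: (Fmor_conj (Opstar F p) (subxx S) Sx).
by move=> y Sy; rewrite norm_conj_autE.
Qed.

(** [Aut0] contains the Sylow subgroup [Inn S] of [AutF F S], so [Gamma_p'] is a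
    [p']-group. *)
Lemma Gamma_p'_p_elt (x : Gamma_p' F p) : p.-elt x -> x = 1.
Proof.
have sylA : p.-Sylow(A) (AutS S S) := fully_normalized_Sylow satF S_fully_normalized.
have p'Q : p^'.-group (A / Aut0 F p).
  rewrite /pgroup card_quotient ?(normal_norm Aut0_normal) //.
  case/and3P: sylA => _ _; rewrite AutS_S; apply: pnat_dvd.
  rewrite -(@Lagrange_index _ A [group of Aut0 F p] [group of Inn S]) ?Inn_Aut0 //.
    exact: dvdn_mulr.
  exact: (normal_sub Aut0_normal).
move=> px; have px' : p.-elt (sgval x).
  by apply: (morph_p_elt (sgval_morphism _)); rewrite ?inE.
have := mem_p_elt p'Q (subgP x) => p'x.
apply: val_inj; apply/eqP; rewrite /= -order_eq1.
by rewrite (pnat_1 px' p'x).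
Qed.

Lemma AutFS_proj_morph : {in AutF F S &, {morph AutFS_proj F p : a b / a * b}}.
Proof.
move=> a b Aa Ab; have nA := subsetP (normal_norm Aut0_normal).
have [Na Nb] := (nA a Aa, nA b Ab).
rewrite /AutFS_proj -subgM ?mem_quotient //=.
by rewrite -morphM.
Qed.

Lemma AutFS_proj_surj (x : Gamma_p' F p) : exists2 a, a \in AutF F S & AutFS_proj F p a = x.
Proof.
have /morphimP[a Na Aa xa] := subgP x; exists a => //.
by rewrite /AutFS_proj /= -[coset _ a]xa sgvalK.
Qed.

Lemma AutFS_proj_eq a b : a \in AutF F S -> b \in AutF F S ->
  AutFS_proj F p a = AutFS_proj F p b -> a * b^-1 \in Aut0 F p.
Proof.
move=> Aa Ab /(congr1 sgval); have nA := subsetP (normal_norm Aut0_normal).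
rewrite !subgK ?mem_quotient // => eab.
apply: coset_idr; first by rewrite groupM ?groupV ?nA.
rewrite morphM ?groupV ?nA // morphV ?nA //= [coset _ a]eab mulgV //.
Qed.

End Quotient.

Theorem proposition2p8 (gT : finGroupType) (p : nat) (S : {group gT})
    (F : fusion_system S) (C : {set {group gT}})
    (theta_F : mor_map gT (Gamma_p' F p)) :
  prime p -> p.-group S ->
  fsaturated F p ->
  C \subset fcentric F ->
  conj_closed F C ->
  (forall P : {group gT}, P \in fcentric F -> fradical F p P -> P \in C) ->
  is_theta theta_F ->
  strongly_multiplicative F p C theta_F /\
  forall (Gamma : groupType) (theta : mor_map gT Gamma),
    strongly_multiplicative F p C theta ->
    exists f : {multiplicative Gamma_p' F p -> Gamma},
      (forall (P Q : {group gT}) (phi : {ffun gT -> gT}),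
         P \in C -> Q \in C -> phi \in F P Q ->
         theta P Q phi = f (theta_F P Q phi)) /\
      (forall g : {multiplicative Gamma_p' F p -> Gamma},
         (forall (P Q : {group gT}) (phi : {ffun gT -> gT}),
            P \in C -> Q \in C -> phi \in F P Q ->
            theta P Q phi = g (theta_F P Q phi)) ->
         g =1 f).
Proof.
move=> p_pr pS satF sCc conjC radC [thFM thFS].
have cS := S_fcentric F; have CS : S \in C := radC S cS (S_fradical satF).
have [uM uE] := mult_untarget cS thFM; set u := untarget S theta_F in uM uE.
have uF : smult F p (fcentric F) u.
  split=> // P a cP Aa pa; apply: (Gamma_p'_p_elt satF).
  have sPS := fcentric_sub cP; apply: pnat_dvd pa; rewrite order_dvdn.
  pose A := Group (AutF_group_set F sPS); have Aa' : a \in A by [].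
  have wM := AutF_morph sPS cP uM.
  have wX n : u P (a ^+ n : {perm gT}) = u P a ^+ n.
    elim: n => [|n IHn]; last first.
      by rewrite !expgS -IHn; apply: wM => //; apply: (groupX n Aa').
    by apply: (mulgI (u P a)); rewrite mulg1 -[LHS]wM ?mulg1 //; apply: (group1 A).
  by rewrite -wX expg_order; apply/eqP; exact: (wX 0).
split.
  split; first by case: thFM => thM th1; split=> [P Q R f g CP CQ CR|P Q CP CQ];
    [apply: thM | apply: th1]; rewrite ?(subsetP sCc).
  move=> P a CP Oa; have cP := subsetP sCc P CP; have sPS := fcentric_sub cP.
  pose A := Group (AutF_group_set F sPS).
  have Aa : a \in A := subsetP (Op'res_sub p_pr (normal_refl A) (fun _ Ab _ => Ab)) a Oa.
  rewrite (uE P P) //; last by case/setIdP: Aa.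
  rewrite /u untarget_AutF.
  apply: (@Op'res_morph _ p A _ (fun b : {perm gT} => u P b)) Oa => //.
    exact: (AutF_morph sPS cP uF).
  by move=> b; apply: (smult_p_elt uF).
move=> Gamma theta thC; have t0C := smult_untarget sCc CS thC.
have [_ thE] := mult_untarget CS (proj1 thC).
have [t [tF tE]] := extend_to_centric pS satF sCc conjC radC t0C.
have tM := AutF_morph (subxx S) cS tF.
have t_proj a b : a \in AutF F S -> b \in AutF F S ->
    AutFS_proj F p a = AutFS_proj F p b -> t S a = t S b.
  pose A := Group (AutF_group_set F (subxx S)).
  move=> Aa Ab /(AutFS_proj_eq Aa Ab)/(Aut0_val p_pr pS tF) tab.
  have Ab' : b^-1 \in A by rewrite groupV.
  have Aab : a * b^-1 \in A by rewrite groupM.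
  by rewrite -[a](mulgKV b) [LHS]tM // [t _ (a * _)]tab mul1g.
have : forall x : Gamma_p' F p, exists a, a \in AutF F S /\ AutFS_proj F p a = x.
  by move=> x; have [a Aa ax] := AutFS_proj_surj x; exists a.
(* [r x] represents [x]; by [t_proj] the choice of representative is immaterial. *)
case/choice=> r rE; pose f x := t S (r x).
have f_proj a : a \in AutF F S -> f (AutFS_proj F p a) = t S a.
  by move=> Aa; have [Ar rP] := rE (AutFS_proj F p a); apply: t_proj.
have fM : {morph f : x y / x * y}.
  move=> x y; have [[Arx rx] [Ary ry]] := (rE x, rE y).
  rewrite -{1}rx -{1}ry -AutFS_proj_morph // f_proj ?tM //.
  by rewrite -[AutF F S]/(gval (Group (AutF_group_set F (subxx S)))) groupM.
have f1 : f 1 = 1 by apply: (mulgI (f 1)); rewrite -fM !mulg1.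
pose fm : {multiplicative Gamma_p' F p -> Gamma} :=
  HB.pack f (isMultiplicative.Build _ _ f fM).
have uS a : a \in AutF F S -> u S a = AutFS_proj F p a.
  by move=> Aa; rewrite -(thFS a Aa).
have fuF : smult F p (fcentric F) (fun P h => fm (u P h)).
  split; first split=> [P h k cP Fh hk|P Q h k cP cQ Fh Fk hQ].
  - by rewrite (mult_eq uM cP Fh hk).
  - by rewrite (mult_comp uM cP cQ Fh Fk hQ) [LHS]fM.
  by move=> P a cP Aa pa; rewrite (smult_p_elt uF).
exists fm; split=> [P Q phi CP CQ Fphi|g gE x].
  have cP := subsetP sCc P CP; have cQ := subsetP sCc Q CQ.
  rewrite (thE P Q) // (uE P Q) // -tE //.
  apply: (smult_unique pS satF tF fuF) => //; last exact: fhom_Fmor Fphi.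
  by move=> a Aa /=; rewrite uS // f_proj.
have [a Aa <-] := AutFS_proj_surj x; rewrite -uS // /u /untarget.
have Fa := AutF_Fmor (subxx S) Aa.
rewrite -gE // (thE S S) // untarget_AutF -tE // /= -f_proj //.
by rewrite -(uS a Aa).
Qed.
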